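(* Let $G$ be a locally compact second countable unimodular group with a fixed Haar measure $m_G$, and let $(X,\mu,Y)$ and $(W,\nu,Z)$ be transverse $G$-spaces. If there exists a transverse $G$-factor $(X,\mu,Y)\to(W,\nu,Z)$, then $$I^r_\mu(Y)=I^r_\nu(Z)\qquad\text{for all } r\in\mathbb{N}.$$
   Context: A Borel $G$-space is a standard Borel space $X$ with a jointly Borel action $G\times X\to X$, $(g,x)\mapsto g.x$. For $Y\subseteq X$ and $x\in X$ put $Y_x=\{g\in G: g.x\in Y\}$. A subset of $G$ is locally finite if it meets every compact set in a finite set. A cross section of $X$ is a Borel set $Y\subseteq X$ with $Y_x$ nonempty and locally finite for every $x\in X$. A transverse $G$-space $(X,\mu,Y)$ consists of a Borel $G$-space $X$, a $G$-invariant Borel probability measure $\mu$ on $X$, and a Borel set $Y\subseteq X$ such that $G.Y$ (a Borel set) is $\mu$-conull, $Y_x$ is locally finite for all $x\in G.Y$, and $\int_X|Y_x\cap K|\,d\mu(x)<\infty$ for every compact $K\subset G$. Transverse measure: for a $G$-invariant $\sigma$-finite measure $\mu$ on a Borel $G$-space $X$ for which $Y$ is a cross section (of $X$, or of a conull invariant Borel subset), $\mu_Y$ is the measure on $Y$ given by $\mu_Y(f)=\int_X\sum_{g\in Y_x}f(g.x)w(g)\,d\mu(x)$ for Borel $f:Y\to[0,+\infty]$, where $w:G\to[0,+\infty]$ is any Borel function with $\int_G w\,dm_G=1$; it is $\sigma$-finite and does not depend on $w$. Intersection covolume: $Y^{\otimes r}$ is the $r$-fold product and $Y^{[r]}=\{(g.y_1,\dots,g.y_r):g\in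 G,\ y_i\in Y\}\subseteq X^{\otimes r}$, a Borel $G$-space under the diagonal action, having $Y^{\otimes r}$ as a cross section. There is exactly one $G$-invariant $\sigma$-finite Borel measure $\mu^{[r]}$ on $Y^{[r]}$ whose transverse measure on $Y^{\otimes r}$ is $\mu_Y^{\otimes r}$. Set $I^r_\mu(Y)=\mu^{[r]}(Y^{[r]})\in(0,+\infty]$. A $G$-factor $\phi:(X,\mu)\to(W,\nu)$ is a Borel map $\phi:X\to W$ with $\phi_*\mu=\nu$ and, for every $g\in G$, $\phi(g.x)=g.\phi(x)$ for $\mu$-a.e. $x$. A transverse $G$-factor $\phi:(X,\mu,Y)\to(W,\nu,Z)$ is a $G$-factor with $Y_x=Z_{\phi(x)}$ for $\mu$-a.e. $x\in X$. *)

(* Defs.v *)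
From HB Require Import structures.
From mathcomp Require Import all_boot all_order all_algebra.
From mathcomp Require Import all_classical all_reals all_analysis.
From mathcomp Require Import measurable_realfun.

Set Implicit Arguments.
Unset Strict Implicit.
Unset Printing Implicit Defensive.

Import Order.TTheory GRing.Theory Num.Theory.
Import numFieldNormedType.Exports.

Local Open Scope classical_set_scope.
Local Open Scope ring_scope.
Local Open Scope ereal_scope.

HB.mixin Record isTopologicalGroup G of Topological G & Group G := {
  mulg_continuous : continuous (fun p : G * G => (p.1 * p.2)%g) ;
  invg_continuous : continuous (fun g : G => (g^-1)%g)
}.

#[short(type="topologicalGroupType")]
HB.structure Definition TopologicalGroup :=
  {G of Topological G & Group G & isTopologicalGroup G}.

Definition lcsc (G : topologicalType) : Prop :=
  [/\ hausdorff_space G, locally_compact [set: G] & @second_countable G].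

(* The alias [borel G] carries the Borel sigma-algebra of [G].  Library
   measurable types are pointed; the neutral element serves as base point. *)
Definition borel (G : topologicalGroupType) : Type := G.

Section borel_instance.
Variable G : topologicalGroupType.

HB.instance Definition _ := Choice.on (borel G).
HB.instance Definition _ := isPointed.Build (borel G) (1%g : G).

Let borel0 : <<s @open G >> (set0 : set (borel G)).
Proof. exact: sigma_algebra0. Qed.

Let borelC (A : set (borel G)) : <<s @open G >> A -> <<s @open G >> (~` A).
Proof. by move=> mA; rewrite -setTD; exact: sigma_algebraCD. Qed.

Let borel_bigcup (F : (set (borel G))^nat) :
  (forall i, <<s @open G >> (F i)) -> <<s @open G >> (\bigcup_i F i).
Proof. exact: sigma_algebra_bigcup. Qed.

HB.instance Definition _ := @isMeasurable.Build (sigma_display (@open G))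
  (borel G) <<s @open G >> borel0 borelC borel_bigcup.

End borel_instance.

Section haar.
Context {R : realType} {G : topologicalGroupType}.

(* On a locally compact second countable group, Borel measures that are finite
   on compact sets are automatically regular. *)
Record haar_measure (m : {measure set (borel G) -> \bar R}) : Prop :=
  HaarMeasure {
    haar_neq0 : m [set: borel G] != 0 ;
    haar_compact : forall K : set G, compact K -> m K < +oo ;
    haar_left_invariant : forall (g : G) (A : set (borel G)),
      measurable A -> m ((fun h : G => (g * h)%g) @^-1` A) = m A }.

(* Together with [haar_measure], this says that the modular function of [G]
   is trivial. *)
Definition right_invariant (m : {measure set (borel G) -> \bar R}) : Prop :=
  forall (g : G) (A : set (borel G)),
    measurable A -> m ((fun h : G => (h * g)%g) @^-1` A) = m A.

Definition locally_finite (A : set G) : Prop :=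
  forall K : set G, compact K -> finite_set (A `&` K).

End haar.

(* Isomorphism with the Borel space of a Polish space; a complete pseudometric
   space whose topology is Hausdorff is a complete metric space. *)
Definition standard_borel (R : realType) d (X : measurableType d) : Prop :=
  exists P : completePseudoMetricType R,
    [/\ hausdorff_space P, @second_countable P &
      exists2 f : X -> P, bijective f &
        forall B : set P, <<s @open P >> B <-> measurable (f @^-1` B)].

Section actions.
Context {R : realType} {G : topologicalGroupType}.
Context {d : measure_display} {X : measurableType d}.
Implicit Types (a : G -> X -> X) (Y : set X).

Record borel_action a : Prop := BorelAction {
  act1 : forall x, a 1%g x = x ;
  actM : forall g h x, a (g * h)%g x = a g (a h x) ;
  act_measurable :
    measurable_fun [set: borel G * X] (fun p : borel G * X => a p.1 p.2) }.

Definition borel_Gspace a : Prop := standard_borel R X /\ borel_action a.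

Definition invariant_measure a (mu : {measure set X -> \bar R}) : Prop :=
  forall g (A : set X), measurable A -> mu (a g @^-1` A) = mu A.

(* [hitting a Y x] is $Y_x$ and [saturation a Y] is $G.Y$. *)
Definition hitting a Y (x : X) : set G := [set g | Y (a g x)].

Definition saturation a Y : set X := [set a g y | g in [set: G] & y in Y].

Record transverse_Gspace a (mu : probability X R) Y : Prop :=
  TransverseGspace {
    tGs_space : borel_Gspace a ;
    tGs_invariant : invariant_measure a mu ;
    tGs_measurable : measurable Y ;
    tGs_conull : \forall x \ae mu, saturation a Y x ;
    tGs_locally_finite :
      forall x, saturation a Y x -> locally_finite (hitting a Y x) ;
    tGs_locally_integrable : forall K : set G, compact K ->
      \int[mu]_x counting (hitting a Y x `&` K) < +oo }.

(* $\mu_Y$ is encoded as a measure on the ambient space that vanishes off [Y]. *)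
Definition transverse_measure (m : {measure set (borel G) -> \bar R}) a
    (mu : {measure set X -> \bar R}) Y (muY : {measure set X -> \bar R})
    : Prop :=
  muY (~` Y) = 0 /\
  forall (w : borel G -> \bar R) (f : X -> \bar R),
    measurable_fun [set: borel G] w -> (forall g, 0 <= w g) ->
    \int[m]_g w g = 1 ->
    measurable_fun Y f -> (forall y, Y y -> 0 <= f y) ->
    \int[muY]_(y in Y) f y =
    \int[mu]_x \esum_(g in hitting a Y x) (f (a g x) * w g).

End actions.

Section intersection.
Context {R : realType} {G : topologicalGroupType}.
Context {d : measure_display} {X : measurableType d}.
Implicit Types (a : G -> X -> X) (Y : set X) (r : nat).

Definition diagonal_action a r (g : G) (t : r.-tuple X) : r.-tuple X :=
  [tuple a g (tnth t i) | i < r].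
Arguments diagonal_action a r g t : clear implicits.

(* $Y^{\otimes r}$ *)
Definition tuple_power Y r : set (r.-tuple X) :=
  [set t | forall i, Y (tnth t i)].
Arguments tuple_power Y r : clear implicits.

(* $Y^{[r]}$ *)
Definition intersection_space a Y r : set (r.-tuple X) :=
  saturation (diagonal_action a r) (tuple_power Y r).
Arguments intersection_space a Y r : clear implicits.

(* The rectangle formula determines the product measure when the factor is
   sigma-finite. *)
Definition product_measure r (la : {measure set X -> \bar R})
    (lar : {measure set (r.-tuple X) -> \bar R}) : Prop :=
  forall A : 'I_r -> set X, (forall i, measurable (A i)) ->
    lar [set t | forall i, A i (tnth t i)] = \prod_(i < r) la (A i).

(* $\mu^{[r]}$ is encoded as a measure on the ambient space of [r]-tuples that
   is carried by $Y^{[r]}$, so that its mass on $Y^{[r]}$ is its total mass;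
   [muY] and [muYr] are $\mu_Y$ and $\mu_Y^{\otimes r}$. *)
Record intersection_measure (m : {measure set (borel G) -> \bar R}) a
    (mu : {measure set X -> \bar R}) Y r
    (mur : {measure set (r.-tuple X) -> \bar R}) : Prop :=
  IntersectionMeasure {
    im_sigma_finite : sigma_finite [set: r.-tuple X] mur ;
    im_invariant : invariant_measure (diagonal_action a r) mur ;
    im_carrier : \forall t \ae mur, intersection_space a Y r t ;
    im_transverse :
      exists (muY : {measure set X -> \bar R})
             (muYr : {measure set (r.-tuple X) -> \bar R}),
        [/\ transverse_measure m a mu Y muY,
            product_measure muY muYr &
            transverse_measure m (diagonal_action a r) mur
              (tuple_power Y r) muYr] }.

Definition intersection_covolume r
    (mur : {measure set (r.-tuple X) -> \bar R}) : \bar R :=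
  mur [set: r.-tuple X].

End intersection.

Section factors.
Context {R : realType} {G : topologicalGroupType}.
Context {dX : measure_display} {X : measurableType dX}.
Context {dW : measure_display} {W : measurableType dW}.
Implicit Types (a : G -> X -> X) (b : G -> W -> W).

Record Gfactor a (mu : probability X R) b (nu : probability W R)
    (phi : X -> W) : Prop := GFactor {
  Gfactor_measurable : measurable_fun [set: X] phi ;
  Gfactor_pushforward : forall B : set W,
    measurable B -> mu (phi @^-1` B) = nu B ;
  Gfactor_equivariant : forall g : G,
    \forall x \ae mu, phi (a g x) = b g (phi x) }.

Definition transverse_Gfactor a (mu : probability X R) (Y : set X)
    b (nu : probability W R) (Z : set W) (phi : X -> W) : Prop :=
  Gfactor a mu b nu phi /\
  \forall x \ae mu, hitting a Y x = hitting b Z (phi x).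

End factors.

(* Main.v *)
Require Import Defs.
From HB Require Import structures.
From mathcomp Require Import all_boot all_order all_algebra finmap.
From mathcomp Require Import all_classical all_reals all_analysis.
From mathcomp Require Import measurable_realfun.

Set Implicit Arguments.
Unset Strict Implicit.
Unset Printing Implicit Defensive.

Import Order.TTheory GRing.Theory Num.Theory.

Local Open Scope classical_set_scope.
Local Open Scope ring_scope.

(** The covolume [mur setT] is a functional of the law of the random set of
return times [hitting a Y x] under [mu], and a transverse factor preserves that
law because it preserves the return times almost everywhere.

For a cross section [T] of a space with measure [la] and transverse measure
[muT], let [Q D] be the integral over [x] of the number of [g] in
[hitting a T x] with [D (g, a g x)].  This is a measure on [G * Z], and by the
defining formula of [muT] it is the product of Haar measure and [muT]
([palm_rect]).  Two uses are made of it.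

- The points [y] of [Y] are sent to [theta y], a Borel code of the set
  [hitting a Y y].  The image [L] of [muY] is determined by the law of the return
  times: by [palm_rect], [mG K * L E] is the mean number of [g] in [K] such
  that [g] is a return time of [x] and the return times seen from [a g x] have
  their code in [E] ([local_stat_law]).  Hence [L] is the same for both spaces
  ([factor_integral_hitting]).

- On [r]-tuples the image [P] of [Q] on [G * traces^r] takes the value
  [mG A * \prod_i L (E i)] on boxes, so [P] is the same for both spaces too.  To
  read the covolume off [P], order [G] so that every nonempty locally finite
  set has a least element ([lexlt_min]).  The pairs [(g, c)] for which [g] is the
  first return time form a set [first_return] that involves the codes only, and
  almost every tuple has exactly one first return, so that
  [P first_return = mur setT] ([trace_model]).

The codes and the set [first_return] are defined by quantifying over [G], so they
involve projections of Borel sets.  These are measurable up to null sets, by the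
measurable projection theorem [ae_measurable_proj], which is proved by Choquet's
capacitability argument.  The theorem also yields measurability of the number of
points in the sections of a Borel set ([ae_mfun_counting]), without which [Q]
would not be additive.

The case [r = 0], where return times need not be locally finite, is a computation
on a one-point space ([covolume_arity0]). *)

(** * Locally compact second countable spaces *)

Definition precompact_base (G : topologicalType) (U : nat -> set G) :=
  [/\ forall n, open (U n),
    forall n, exists2 K, compact K & U n `<=` K &
    forall x V, nbhs x V ->
      exists n, U n x /\ exists2 K, compact K & U n `<=` K /\ K `<=` V].

Lemma lcsc_precompact_base (G : topologicalType) : lcsc G ->
  exists U : nat -> set G, precompact_base U.
Proof.
move=> [hG lG [B cB [oB bB]]].
pose B' := [set A | B A /\ exists2 K, compact K & A `<=` K].
have /countable_injP[f finj] : countable B'.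
  by apply: sub_countable cB; apply: subset_card_le => A [].
pose U n := [set x | exists A, [/\ B' A, f A = n & A x]].
have UE A : B' A -> U (f A) = A.
  move=> B'A; apply/seteqP; split=> [x [A' [B'A' fE A'x]]|x Ax].
    by rewrite -(finj _ _ _ _ fE)// inE.
  by exists A.
have U0 n : ~ (exists2 A, B' A & f A = n) -> U n = set0.
  by move=> nA; apply/seteqP; split=> // x [A [B'A fA _]]; case: nA; exists A.
exists U; split.
- move=> n; have [[A B'A <-]|/U0 ->] := pselect (exists2 A, B' A & f A = n).
    by rewrite UE//; apply: oB; case: B'A.
  exact: open0.
- move=> n; have [[A B'A <-]|/U0 ->] := pselect (exists2 A, B' A & f A = n).
    by rewrite UE//; case: B'A.
  by exists set0; [exact: compact0|].
- move=> x V xV.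
  have [K0 xK0 [cK0 clK0]] : exists2 K, nbhs x K & compact K /\ closed K.
    have [K xK cK] := lG x I; exists K => //.
    by move: xK; rewrite /within/=; apply: filterS => y; exact.
  have [P xP PV] := compact_regular hG cK0 xK0 (filterI xV xK0).
  have [A [BA Ax] AP] := bB x P xP.
  have cP : compact (closure P).
    by apply: subclosed_compact cK0 _; [exact: closed_closure|move=> y /PV[]].
  have AK : A `<=` closure P by move=> y /AP; exact: subset_closure.
  have B'A : B' A by split=> //; exists (closure P).
  exists (f A); rewrite UE//; split=> //; exists (closure P) => //.
  by split=> // y /PV[].
Qed.

(** An open set is the union of the base elements that fit in it together with a
compact neighbourhood; each of them contributes one such compact set. *)
Lemma open_sigma_compact (G : topologicalType) (O : set G) : lcsc G -> open O ->
  exists K : nat -> set G, (forall n, compact (K n)) /\ O = \bigcup_n K n.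
Proof.
move=> /lcsc_precompact_base[U [oU cU bU]] oO.
pose P n K := [/\ compact K, K `<=` O &
  ((exists2 K', compact K' & U n `<=` K' /\ K' `<=` O) -> U n `<=` K)].
have /choice[K hK] : forall n, exists K, P n K.
  move=> n; have [[K cK [UK KO]]|nK] :=
    pselect (exists2 K', compact K' & U n `<=` K' /\ K' `<=` O).
    by exists K.
  by exists set0; split=> //; exact: compact0.
exists K; split=> [n|]; first by have [] := hK n.
apply/seteqP; split=> [x Ox|x [n _ Kx]]; last by have [_ + _] := hK n; exact.
have [n [Ux [K' cK' UKO]]] := bU x O (open_nbhs_nbhs (conj oO Ox)).
by exists n => //; have [_ _] := hK n; apply=> //; exists K'.
Qed.

(** * Souslin schemes and capacitability *)

Definition agree (n : nat) (s t : nat -> nat) :=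
  forall i, (i < n)%N -> s i = t i.

(** Only the restriction of a sequence to an initial segment matters below, so
sequences stand for their finite prefixes and [upd] extends a prefix by one
entry. *)
Definition upd (s : nat -> nat) (n j : nat) : nat -> nat :=
  fun i => if i == n then j else s i.

(** Dependent choice along the prefix tree.  It serves twice: to find a bounding
sequence in Choquet's theorem, and, as Koenig's lemma, to find a branch below
such a bound. *)
Lemma tree_branch (good : nat -> (nat -> nat) -> Prop) :
  (forall n s t, agree n s t -> good n s -> good n t) ->
  good 0%N (fun=> 0%N) ->
  (forall n s, good n s -> exists j, good n.+1 (upd s n j)) ->
  exists s, forall n, good n s.
Proof.
move=> gagree g0 gS.
have /choice[f hf] : forall p : nat * (nat -> nat), exists j,
    good p.1 p.2 -> good p.1.+1 (upd p.2 p.1 j).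
  move=> [n s]; have [/gS[j gj]|ng] := pselect (good n s); first by exists j.
  by exists 0%N.
pose M := fix M n := if n is n'.+1 then upd (M n') n' (f (n', M n'))
                     else (fun=> 0%N).
have gM n : good n (M n) by elim: n => [//|n IHn] /=; exact: (hf (n, M n)).
have MS i n : (i < n)%N -> M n i = M i.+1 i.
  elim: n => // n IHn; rewrite ltnS leq_eqVlt => /predU1P[->//|ltin].
  by rewrite /= {1}/upd ltn_eqF// IHn.
exists (fun i => M i.+1 i) => n.
by apply: gagree (gM n) => i ltin; rewrite (MS i n).
Qed.

Section Souslin.
Variables (T : Type) (P : set (set T)).

(** The [n]-th set may depend on the first [n] entries of the branch only, so that
at depth [0] there is no freedom at all: this makes the operations below
respect depths exactly. *)
Definition scheme (S : nat -> (nat -> nat) -> set T) :=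
  (forall n s t, agree n s t -> S n s = S n t) /\ (forall n s, P (S n s)).

Definition souslin (B : set T) :=
  exists S, scheme S /\ B = \bigcup_s \bigcap_n S n s.

Lemma souslin_paving B : P B -> souslin B.
Proof.
move=> PB; exists (fun _ _ => B); split=> //; apply/seteqP; split=> [x Bx|x].
  by exists (fun=> 0%N).
by move=> [s _ /(_ 0%N I)].
Qed.

Hypothesis PT : P setT.

(** The index of the union becomes the first entry of the branch.  Reading it
costs one level, at which the whole space is used. *)
Lemma souslin_bigcup (B : nat -> set T) :
  (forall k, souslin (B k)) -> souslin (\bigcup_k B k).
Proof.
move=> /choice[S hS].
have SS k : scheme (S k) by have [] := hS k.
have BE k : B k = \bigcup_s \bigcap_n S k n s by have [] := hS k.
exists (fun n s => if n is n'.+1 then S (s 0%N) n' (fun i => s i.+1) else setT).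
split.
  split=> [[//|n] s t st|[//|n] s]; last by have [] := SS (s 0%N).
  by rewrite (st 0%N)//; have [+ _] := SS (t 0%N); apply=> i ltin; exact: st.
apply/seteqP; split=> [x [k _]|x [s _ h]].
  rewrite BE => -[s _ h]; exists (fun i => if i is i'.+1 then s i' else k) => //.
  by move=> [//|n] _ /=; exact: h.
by exists (s 0%N) => //; rewrite BE; exists (fun i => s i.+1) => // n _;
  have := h n.+1 I.
Qed.

(** Countably many branches are interleaved into one through
[(k, i) |-> 2 ^ k * (2 i + 1)].  This pairing is increasing in [i], so the entries
of the [k]-th branch needed by a set are available at the level of that set. *)
Lemma souslin_bigcap (B : nat -> set T) :
  (forall k, souslin (B k)) -> souslin (\bigcap_k B k).
Proof.
move=> /choice[S hS].
have SS k : scheme (S k) by have [] := hS k.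
have BE k : B k = \bigcup_s \bigcap_n S k n s by have [] := hS k.
pose pair k i := (2 ^ k * i.*2.+1)%N.
pose fstn m := logn 2 m.
pose sndn m := (m %/ 2 ^ fstn m)./2.
have fst_pair k i : fstn (pair k i) = k.
  rewrite /fstn /pair lognM// ?expn_gt0// pfactorK//.
  by rewrite (_ : logn 2 i.*2.+1 = 0%N) ?addn0// lognE dvdn2 /= odd_double.
have snd_pair k i : sndn (pair k i) = i.
  by rewrite /sndn fst_pair /pair mulKn ?expn_gt0// -[i.*2.+1]/(true + _)%N half_bit_double.
exists (fun m s => S (fstn m) (sndn m) (fun i => s (pair (fstn m) i))); split.
  split=> [m s t st|m s]; last by have [] := SS (fstn m).
  have [+ _] := SS (fstn m); apply=> i lti; apply: st.
  apply: (@leq_trans (2 ^ fstn m * (sndn m).*2)%N).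
    by rewrite /pair ltn_pmul2l ?expn_gt0// -doubleS leq_double.
  apply: leq_trans (leq_trunc_div m (2 ^ fstn m)).
  rewrite mulnC leq_pmul2r ?expn_gt0//.
  by rewrite -[leqRHS]odd_double_half leq_addl.
apply/seteqP; split=> [x Bx|x [s _ h] k _].
  have /choice[s hs] : forall k, exists s, forall n, S k n s x.
    by move=> k; have := Bx k I; rewrite BE => -[s _ h]; exists s => n; exact: h.
  exists (fun m => s (fstn m) (sndn m)) => // m _ /=.
  rewrite (_ : (fun i => _) = s (fstn m)); first exact: hs.
  by apply/funext => i; rewrite fst_pair snd_pair.
rewrite BE; exists (fun i => s (pair k i)) => // n _.
by have := h (pair k n) I; rewrite fst_pair snd_pair.
Qed.

(** The approximation at depth [n] of the part of the Souslin set that comes from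
branches bounded by [m]: the boundedness replaces a countable union by a finite
one, which keeps the set in the paving. *)
Definition bounded_part (S : nat -> (nat -> nat) -> set T) (m : nat -> nat) n :=
  [set x | exists s, (forall i, (s i <= m i)%N) /\ forall k, (k < n)%N -> S k s x].

(** Koenig's lemma: below [m] the prefix tree is finitely branching, so a point
that survives at every depth follows an infinite branch. *)
Lemma bigcap_bounded_part S m : scheme S ->
  \bigcap_n bounded_part S m n `<=` \bigcup_s \bigcap_n S n s.
Proof.
move=> [Sagree _] x hx.
pose good n t := forall N, exists s, [/\ forall i, (s i <= m i)%N, agree n s t &
  forall k, (k < N)%N -> S k s x].
have [t ht] : exists t, forall n, good n t.
  apply: tree_branch.
  - move=> n s t st gs N; have [s' [s'm s's h]] := gs N.
    by exists s'; split=> // i ltin; rewrite s's// st.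
  - by move=> N; have [s [sm h]] := hx N I; exists s; split.
  - move=> n t gt; apply: contrapT => /forallNP ng.
    have /choice[N hN] : forall j, exists N, ~ exists s,
        [/\ forall i, (s i <= m i)%N, agree n.+1 s (upd t n j) &
            forall k, (k < N)%N -> S k s x].
      by move=> j; have /existsNP := ng j.
    (* If every extension of t fails, say at depth N j, then a branch through t that
       lasts beyond all N j with j <= m n contradicts the choice of N for its own
       entry. *)
    have [s [sm st h]] := gt (\max_(j < (m n).+1) N j)%N.
    apply: (hN (s n)); exists s; split=> // [i|k ltkN].
      rewrite ltnS leq_eqVlt /upd => /predU1P[->|ltin]; first by rewrite eqxx.
      by rewrite ltn_eqF// st.
    apply: h; apply: leq_trans ltkN _.
    have sn : (s n < (m n).+1)%N by rewrite ltnS.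
    exact: (leq_bigmax (Ordinal sn)).
exists t => // n _; have [s [_ st h]] := ht n n.+1.
by rewrite -(Sagree _ _ _ st); exact: h.
Qed.

(** Choquet's capacitability theorem, for the family [small] of sets of capacity at
most a given level.  Bounding one more entry of the branches exhausts the set
by an increasing union, so a large enough bound keeps it from being small; the
bounds so chosen are never undone.  Continuity along decreasing sequences in the
paving is applied afterwards, to [bounded_part]. *)
Lemma choquet (small : set T -> Prop) S : scheme S ->
  (forall A B, A `<=` B -> small B -> small A) ->
  (forall A : nat -> set T, (forall i j, (i <= j)%N -> A i `<=` A j) ->
     (forall i, small (A i)) -> small (\bigcup_i A i)) ->
  ~ small (\bigcup_s \bigcap_n S n s) ->
  exists m, forall n, ~ small (bounded_part S m n).
Proof.
move=> [Sagree _] smallS smallU nsB.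
pose Bn n m := [set x | exists s, (forall i, (i < n)%N -> (s i <= m i)%N) /\
                          forall k, S k s x].
have [m hm] : exists m, forall n, ~ small (Bn n m).
  apply: tree_branch.
  - move=> n s t st; apply: contra_not; apply: smallS => x [u [us h]].
    by exists u; split=> // i ltin; rewrite -st// us.
  - by apply: contra_not nsB; apply: smallS => x [s _ h]; exists s; split=> // k;
      exact: h.
  - move=> n m nsn; apply: contrapT => /forallNP hj.
    have {}hj j : small (Bn n.+1 (upd m n j)) by exact: contrapT (hj j).
    apply: nsn; apply: smallS (smallU _ _ hj).
      move=> x [s [sm h]]; exists (s n) => //; exists s; split=> // i.
      rewrite ltnS leq_eqVlt /upd => /predU1P[->|ltin]; first by rewrite eqxx.
      by rewrite ltn_eqF// sm.
    move=> i j leij x [s [sm h]]; exists s; split=> // k ltk.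
    apply: leq_trans (sm k ltk) _.
    by rewrite /upd; case: ifP.
exists m => n; apply: contra_not (hm n); apply: smallS => x [s [sm h]].
(* Entries from n on do not affect the first n sets, so they may be truncated. *)
exists (fun i => minn (s i) (m i)); split=> [i|k ltkn]; first exact: geq_minr.
rewrite (Sagree _ _ s)// => i ltik; apply/minn_idPl; apply: sm.
exact: ltn_trans ltkn.
Qed.

Hypothesis PU : forall A B, P A -> P B -> P (A `|` B).
Hypothesis PI : forall A B, P A -> P B -> P (A `&` B).

Let paving_bounded_union m n (F : (nat -> nat) -> set T) :
  (forall s t, agree n s t -> F s = F t) -> (forall s, P (F s)) ->
  P [set x | exists s, (forall i, (s i <= m i)%N) /\ F s x].
Proof.
elim: n F => [|n IHn] F Fagree PF.
  rewrite (_ : [set x | _] = F (fun=> 0%N))//; apply/seteqP; split=> [x [s []]|].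
    by move=> _; rewrite (Fagree _ (fun=> 0%N)).
  by move=> x Fx; exists (fun=> 0%N).
pose F' j s := [set x | exists2 i, (i <= j)%N & F (upd s n i) x].
have PF' j s : P (F' j s).
  elim: j => [|j IHj].
    rewrite (_ : F' _ _ = F (upd s n 0))//; apply/seteqP; split=> [x [i]|x].
      by rewrite leqn0 => /eqP ->.
    by exists 0%N.
  rewrite (_ : F' _ _ = F' j s `|` F (upd s n j.+1)); first exact: PU.
  apply/seteqP; split=> [x [i]|x [[i lij]|]]; last by exists j.+1.
    rewrite leq_eqVlt ltnS => /predU1P[->|lij]; [by right|by left; exists i].
  by exists i => //; exact: leqW.
rewrite (_ : [set x | _] =
    [set x | exists s, (forall i, (s i <= m i)%N) /\ F' (m n) s x]).
  apply: IHn => // s t st.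
  have E i : F (upd s n i) = F (upd t n i).
    apply: Fagree => k; rewrite ltnS /upd leq_eqVlt => /predU1P[->|kn].
      by rewrite eqxx.
    by rewrite ltn_eqF// st.
  by apply/seteqP; split=> x [i lei]; [rewrite E|rewrite -E] => Fx; exists i.
apply/seteqP; split=> [x [s [sm Fx]]|x [s [sm [j lej Fx]]]].
  exists s; split=> //; exists (s n) => //.
  rewrite (_ : upd _ _ _ = s)//; apply/funext => i; rewrite /upd.
  by case: eqP => [->|].
exists (upd s n j); split=> // i; rewrite /upd.
by case: eqP => [->|].
Qed.

Lemma paving_bounded_part S m n : scheme S -> P (bounded_part S m n).
Proof.
move=> [Sagree PS].
apply: (@paving_bounded_union m n
  (fun s => [set x | forall k, (k < n)%N -> S k s x])) => [s t st|s].
  apply/seteqP; split=> x h k ltkn; have := h k ltkn;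
    by rewrite (Sagree k s t)// => i ltik; apply: st; exact: ltn_trans ltkn.
elim: n => [|n IHn]; first by rewrite (_ : [set x | _] = setT)//; exact/seteqP.
rewrite (_ : [set x | _] = [set x | forall k, (k < n)%N -> S k s x] `&` S n s).
  exact: PI.
apply/seteqP; split=> [x h|x [h1 h2] k].
  by split=> [k ltkn|]; apply: h => //; exact: leqW.
by rewrite ltnS leq_eqVlt => /predU1P[->//|]; exact: h1.
Qed.

End Souslin.

Local Open Scope ereal_scope.

(** * The measurable projection theorem *)

Definition ae_measurable d (Z : measurableType d) (R : realType)
    (la : {measure set Z -> \bar R}) (A : set Z) :=
  exists A' N, [/\ measurable A', measurable N, la N = 0 &
    forall z, ~ N z -> (A z <-> A' z)].

Section ae_measurable.
Context d (Z : measurableType d) (R : realType).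
Implicit Types (la : {measure set Z -> \bar R}).

Lemma measurable_ae la A : measurable A -> ae_measurable la A.
Proof.
move=> mA; exists A, set0; split=> //; exact: measure0.
Qed.

Lemma ae_measurable_bigcup la (A : nat -> set Z) :
  (forall n, ae_measurable la (A n)) -> ae_measurable la (\bigcup_n A n).
Proof.
move=> /choice[A' /choice[N h]].
exists (\bigcup_n A' n), (\bigcup_n N n); split.
- by apply: bigcupT_measurable => n; have [] := h n.
- by apply: bigcupT_measurable => n; have [] := h n.
- apply/negligibleP; last apply: negligible_bigcup => n.
    by apply: bigcupT_measurable => n; have [] := h n.
  by apply/negligibleP; have [] := h n.
- move=> z nNz; split=> -[n _ Anz]; exists n => //; have [_ _ _ hz] := h n;
    by apply/hz => // Nz; apply: nNz; exists n.
Qed.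

Lemma ae_measurableI la (A B : set Z) :
  ae_measurable la A -> ae_measurable la B -> ae_measurable la (A `&` B).
Proof.
move=> [A' [N [mA' mN N0 hA]]] [B' [M [mB' mM M0 hB]]].
exists (A' `&` B'), (N `|` M); split; [exact: measurableI|exact: measurableU| |].
- apply/negligibleP; first exact: measurableU.
  by apply: negligibleU; exact/negligibleP.
- move=> z /not_orP[nN nM]; have := hA z nN; have := hB z nM.
  by move=> [? ?] [? ?]; split=> -[? ?]; split; auto.
Qed.

(** A set whose inner and outer measures agree is squeezed between measurable sets
whose difference has arbitrarily small measure. *)
Lemma capacitable_ae_measurable la (A : set Z) : la setT < +oo ->
  (forall a : R,
    (exists P, [/\ measurable P, A `<=` P & la P <= a%:E]) \/
    (exists P, [/\ measurable P, P `<=` A & a%:E <= la P])) ->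
  ae_measurable la A.
Proof.
move=> fla hA.
have laf P : measurable P -> la P \is a fin_num.
  move=> mP; rewrite ge0_fin_numE//; apply: le_lt_trans fla.
  by apply: le_measure; rewrite ?inE.
have gap (e : R) : (0 < e)%R -> exists P : set Z * set Z,
    [/\ measurable P.1, measurable P.2, P.1 `<=` A, A `<=` P.2 &
        la (P.2 `\` P.1) <= e%:E].
  move=> e0.
  (* On the grid of step e take the least level bounding the outer measure; the
     level below it is then a lower bound for the inner measure. *)
  pose outer k := `[< exists P, [/\ measurable P, A `<=` P & la P <= (k%:R * e)%:E] >].
  have exk : exists k, outer k.
    have [k hk] : exists k : nat, (fine (la setT) <= k%:R * e)%R.
      exists (Num.truncn (fine (la setT) / e)).+1; rewrite -ler_pdivrMr//.
      by apply/ltW/truncnS_gt.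
    exists k; apply/asboolP; exists setT; split=> //.
    by rewrite -(fineK (laf _ measurableT)) lee_fin.
  case: (ex_minnP exk) => k /asboolP[P [mP AP laP]] kmin.
  case: k => [|k] in kmin laP *.
    exists (set0, P); split=> //=; rewrite setD0 (le_trans laP)// mul0r lee_fin.
    exact: ltW.
  have [ok|[I [mI IA laI]]] := hA (k%:R * e)%R.
    by have := kmin k (asboolT ok); rewrite ltnn.
  exists (I, P); split=> //=; rewrite measureD//; last by rewrite -ge0_fin_numE// laf.
  rewrite (_ : P `&` I = I); last by apply/setIidPr; exact: subset_trans AP.
  apply: (@le_trans _ _ ((k.+1%:R * e)%:E - (k%:R * e)%:E)).
    exact: leeB.
  by rewrite -EFinB lee_fin -mulrBl -natrB// subSnn mul1r.
have /choice[P hP] : forall n : nat, exists P : set Z * set Z,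
    [/\ measurable P.1, measurable P.2, P.1 `<=` A, A `<=` P.2 &
        la (P.2 `\` P.1) <= (n.+1%:R^-1)%:E].
  by move=> n; apply: gap; rewrite invr_gt0.
have mD n : measurable ((P n).2 `\` (P n).1).
  by have [? ? _ _ _] := hP n; exact: measurableD.
exists (\bigcup_n (P n).1), (\bigcap_n ((P n).2 `\` (P n).1)); split.
- by apply: bigcupT_measurable => n; have [] := hP n.
- by apply: bigcapT_measurable.
- apply/eqP; rewrite eq_le measure_ge0 andbT; apply/lee_addgt0Pr => e e0.
  rewrite add0e.
  have [n hn] : exists n : nat, (n.+1%:R^-1 <= e)%R.
    exists (Num.truncn e^-1); rewrite -[leRHS]invrK lef_pV2 ?posrE ?invr_gt0//.
    exact/ltW/truncnS_gt.
  apply: (@le_trans _ _ (la ((P n).2 `\` (P n).1))).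
    apply: le_measure; rewrite ?inE//; [exact: bigcapT_measurable|].
    by move=> z; exact.
  by have [_ _ _ _ h] := hP n; apply: le_trans h _; rewrite lee_fin.
- move=> z /existsNP[n /not_implyP[_ nPz]]; have [_ _ PA AP _] := hP n.
  split=> [Az|[k _ Pz]]; last by have [_ _ + _ _] := hP k; exact.
  by exists n => //; apply: contrapT => nP1; apply: nPz; split; [exact: AP|].
Qed.

End ae_measurable.

Section projection.
Context (G : topologicalGroupType) (lcG : lcsc G) d (Z : measurableType d).
Context (R : realType).

(** The paving of Choquet's theorem: finite unions of rectangles with a closed
side in [G].  Its sections are closed, its projections are trivially measurable,
and it contains the whole space. *)
Inductive paved : set (borel G * Z) -> Prop :=
| paved0 : paved set0
| pavedU C E D : closed (C : set G) -> measurable E -> paved D ->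
    paved ((C `*` E) `|` D).

Lemma paved_rect C E : closed (C : set G) -> measurable E -> paved (C `*` E).
Proof. by move=> cC mE; rewrite -[_ `*` _]setU0; exact: pavedU paved0. Qed.

Lemma pavedT : paved setT.
Proof. by rewrite -setXTT; apply: paved_rect => //; exact: closedT. Qed.

Lemma paved_setU A B : paved A -> paved B -> paved (A `|` B).
Proof.
by move=> pA pB; elim: pA => [|C E D cC mE _ ih]; rewrite ?set0U// -setUA; exact: pavedU.
Qed.

Lemma paved_setI A B : paved A -> paved B -> paved (A `&` B).
Proof.
move=> pA pB; elim: pA => [|C E D cC mE _ ih]; first by rewrite set0I; exact: paved0.
rewrite setIUl; apply: paved_setU ih; elim: pB => [|C' E' D' cC' mE' _ ih'].
  by rewrite setI0; exact: paved0.
rewrite setIUr; apply: paved_setU ih'; rewrite -setXI.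
by apply: paved_rect; [exact: closedI|exact: measurableI].
Qed.

Lemma paved_closed D z : paved D -> closed ([set g | D (g, z)] : set G).
Proof.
elim=> [|C E D' cC mE _ ih]; first exact: closed0.
have [Ez|nEz] := pselect (E z).
  rewrite (_ : [set g | _] = C `|` [set g | D' (g, z)]); first exact: closedU.
  by apply/seteqP; split=> [g [[]|]|g [|]]; [left|right|left|right].
by rewrite (_ : [set g | _] = [set g | D' (g, z)])//;
  apply/seteqP; split=> [g [[]|]|g]//; right.
Qed.

Definition compact_proj (K : set G) (D : set (borel G * Z)) : set Z :=
  [set z | exists2 g, K g & D (g, z)].

Lemma paved_measurable_proj K D : paved D -> measurable (compact_proj K D).
Proof.
elim=> [|C E D' cC mE _ ih].
  by rewrite (_ : compact_proj _ _ = set0)//; apply/seteqP; split=> [z []|].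
rewrite (_ : compact_proj _ _ = compact_proj K (C `*` E) `|` compact_proj K D').
  apply: measurableU => //.
  have [[g Kg Cg]|nKC] := pselect (exists2 g, K g & C g).
    rewrite (_ : compact_proj _ _ = E)//; apply/seteqP; split=> [z [h _ []]//|z Ez].
    by exists g.
  rewrite (_ : compact_proj _ _ = set0)//; apply/seteqP; split=> [z [h Kh []]|//].
  by move=> /= Ch; exfalso; apply: nKC; exists h.
by apply/seteqP; split=> [z [g Kg [|]]|z [[g Kg]|[g Kg]]];
  [left; exists g|right; exists g|exists g => //; left|exists g => //; right].
Qed.

(** Projection along a compact set commutes with decreasing intersections of
closed sections: this is the continuity from above required of a capacity. *)
Lemma bigcap_compact_proj (K : set G) (D : nat -> set (borel G * Z)) :
  compact K -> (forall n, paved (D n)) ->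
  (forall i j, (i <= j)%N -> D j `<=` D i) ->
  \bigcap_n compact_proj K (D n) `<=` compact_proj K (\bigcap_n D n).
Proof.
move=> cK pD Ddecr z hz.
pose F (n : nat) := [set g : G | D n (g, z)].
have cF n : closed (F n) by exact: paved_closed.
have [g [Kg hg]] : K `&` (\bigcap_n F n) !=set0.
  pose H := filter_from [set: nat] (fun n => K `&` F n).
  have PH : ProperFilter H.
    apply: filter_from_proper.
      apply: filter_fromT_filter; first by exists 0%N.
      move=> i j; exists (maxn i j) => g [Kg Fg].
      by split; split=> //; apply: Ddecr Fg; rewrite ?leq_maxl ?leq_maxr.
    by move=> n _; have [g Kg hg] := hz n I; exists g.
  have HF n : H (K `&` F n) by exists n.
  have HK : H K by exists 0%N => // g [].
  have [g [Kg clg]] := cK H PH HK.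
  exists g; split=> // n _; apply: (cF n) => B gB.
  by have [h [[_ ?] ?]] := clg _ _ (HF n) gB; exists h.
by exists g => // n _; exact: hg.
Qed.

(** The capacity of a set is the outer measure of its projection.  It goes up along
increasing unions by passing to the inferior limit of measurable covers, and
down along [bounded_part] by compactness; the projections of [bounded_part]
then approximate from inside a set that is not covered cheaply. *)
Lemma compact_proj_capacitable (la : {measure set Z -> \bar R}) (K : set G) B :
  la setT < +oo -> compact K -> souslin paved B ->
  ae_measurable la (compact_proj K B).
Proof.
move=> fla cK [S [schS BE]]; apply: capacitable_ae_measurable => // a.
pose small (D : set (borel G * Z)) :=
  exists P, [/\ measurable P, compact_proj K D `<=` P & la P <= a%:E].
have projS C D : C `<=` D -> compact_proj K C `<=` compact_proj K D.
  by move=> CD z [g Kg Cg]; exists g => //; exact: CD.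
have smallS C D : C `<=` D -> small D -> small C.
  move=> CD [P [mP DP laP]]; exists P; split=> //.
  exact: subset_trans (projS _ _ CD) DP.
have smallU (A : nat -> set (borel G * Z)) :
    (forall i j, (i <= j)%N -> A i `<=` A j) ->
    (forall i, small (A i)) -> small (\bigcup_i A i).
  move=> Aincr /choice[P hP].
  have mP i : measurable (P i) by have [] := hP i.
  pose Q i := \bigcap_j P (i + j)%N.
  have mQ i : measurable (Q i) by exact: bigcapT_measurable.
  have Qincr : nondecreasing_seq Q.
    move=> i j leij; apply/subsetPset => z h k _.
    by rewrite -(subnKC leij) -addnA; exact: h.
  exists (\bigcup_i Q i); split.
  - exact: bigcupT_measurable.
  - move=> z [g Kg [i _ Ag]]; exists i => // j _.
    have [_ + _] := hP (i + j)%N; apply; exists g => //.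
    by apply: Aincr Ag; exact: leq_addr.
  - have cvQ := nondecreasing_cvg_mu mQ (bigcupT_measurable _ mQ) Qincr (mu := la).
    rewrite -(cvg_lim _ cvQ)//; apply: lime_le; first exact: cvgP cvQ.
    apply: nearW => i /=; have [_ _] := hP i; apply: le_trans.
    apply: le_measure; rewrite ?inE//.
    by move=> z /(_ 0%N I); rewrite addn0.
have [|nsB] := pselect (small B); first by left.
have mpart m n : paved (bounded_part S m n).
  exact: (paving_bounded_part pavedT paved_setU paved_setI).
have [m hm] : exists m, forall n, ~ small (bounded_part S m n).
  by apply: choquet schS smallS smallU _; rewrite -BE.
pose Q n := compact_proj K (bounded_part S m n).
have mQ n : measurable (Q n) by apply: paved_measurable_proj; exact: mpart.
have decr i j : (i <= j)%N -> bounded_part S m j `<=` bounded_part S m i.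
  move=> leij x [s [sm h]]; exists s; split=> // k ltki; apply: h.
  exact: leq_trans leij.
have Qdecr : nonincreasing_seq Q.
  by move=> i j leij; apply/subsetPset; apply: projS; exact: decr.
right; exists (\bigcap_n Q n); split; first exact: bigcapT_measurable.
  apply: subset_trans (bigcap_compact_proj cK (mpart m) decr) _.
  by apply: projS; rewrite BE; exact: bigcap_bounded_part schS.
have Q0fin : la (Q 0%N) < +oo.
  by apply: le_lt_trans fla; apply: le_measure; rewrite ?inE.
have cvQ := nonincreasing_cvg_mu Q0fin mQ (bigcapT_measurable mQ) Qdecr.
rewrite -(cvg_lim _ cvQ)//; apply: lime_ge; first exact: cvgP cvQ.
apply: nearW => n /=; rewrite leNgt; apply/negP => lt; apply: (hm n).
by exists (Q n); split=> //; exact: ltW.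
Qed.

(** Souslin sets are not closed under complement; the Souslin sets with Souslin
complement form a sigma-algebra. *)
Definition bisouslin (B : set (borel G * Z)) :=
  souslin paved B /\ souslin paved (~` B).

Lemma sigma_algebra_bisouslin : sigma_algebra setT bisouslin.
Proof.
have sT : souslin paved setT by apply: souslin_paving; exact: pavedT.
have s0 : souslin paved set0 by apply: souslin_paving; exact: paved0.
split.
- by split=> //; rewrite setC0.
- by move=> A [sA sAC]; rewrite setTD; split=> //; rewrite setCK.
- move=> A sA; split; first by apply: (souslin_bigcup pavedT) => k; case: (sA k).
  rewrite setC_bigcup; apply: souslin_bigcap => k.
  by case: (sA k).
Qed.

Lemma measurable_souslin (B : set (borel G * Z)) : measurable B -> souslin paved B.
Proof.
move=> mB; suff: bisouslin B by case.
move: B mB; apply: smallest_sub; first exact: sigma_algebra_bisouslin.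
have [hG _ _] := lcG.
rewrite subUset; split=> _ [A mA <-]; rewrite setTI; last first.
  split; apply: souslin_paving.
    by rewrite -setTX; apply: paved_rect => //; exact: closedT.
  rewrite preimage_setC -setTX; apply: paved_rect; first exact: closedT.
  exact: measurableC.
have : sigma_algebra setT [set A : set (borel G) | bisouslin (fst @^-1` A)].
  have [h0 hC hU] := sigma_algebra_bisouslin; split.
  - by rewrite /= preimage_set0.
  - by move=> C /= /hC; rewrite !setTD.
  - by move=> C /= /hU; rewrite preimage_bigcup.
move=> /smallest_sub; apply; last exact: mA.
move=> O oO /=; split.
  have [K [cK ->]] := open_sigma_compact lcG oO.
  rewrite preimage_bigcup; apply: souslin_bigcup; first exact: pavedT.
  move=> k; apply: souslin_paving; rewrite -setXT; apply: paved_rect => //.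
  exact: compact_closed.
rewrite preimage_setC -setXT; apply: souslin_paving; apply: paved_rect => //.
exact: open_closedC.
Qed.

(** The measurable projection theorem.  It reduces to finite measures and to
projections along compact sets by exhausting [Z] and [G]. *)
Lemma ae_measurable_proj (la : {measure set Z -> \bar R}) (B : set (borel G * Z)) :
  sigma_finite setT la -> measurable B ->
  ae_measurable la [set z | exists g, B (g, z)].
Proof.
move=> [F FT hF] mB.
have [K [cK KT]] := open_sigma_compact lcG (@openT G).
rewrite (_ : [set z | _] = \bigcup_j (F j `&` \bigcup_i compact_proj (K i) B)); last first.
  apply/seteqP; split=> [z [g Bg]|z [j _ [_ [i _ [g _ Bg]]]]]; last by exists g.
  have : (\bigcup_i F i) z by rewrite -FT.
  have : (\bigcup_i K i) g by rewrite -KT.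
  by move=> [i _ Kg] [j _ Fz]; exists j => //; split=> //; exists i => //; exists g.
apply: ae_measurable_bigcup => j; have [mF Ffin] := hF j.
have : ae_measurable (mrestr la mF) (\bigcup_i compact_proj (K i) B).
  apply: ae_measurable_bigcup => i; apply: compact_proj_capacitable => //.
    by apply: le_lt_trans Ffin; apply: le_measure; rewrite ?inE// setTI.
  exact: measurable_souslin.
move=> [A' [N [mA' mN N0 hA]]]; exists (F j `&` A'), (F j `&` N); split=> //.
- exact: measurableI.
- exact: measurableI.
- by rewrite setIC.
- move=> z nN; split=> -[Fz h]; split=> //; apply/hA => // Nz; exact: nN.
Qed.

End projection.

(** * Lower integrals and the number of points of a section *)

Definition atleast (T : eqType) k (S : set T) :=
  exists s : seq T, [/\ uniq s, size s = k & forall g, g \in s -> S g].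

Lemma counting_ge0 (T : choiceType) (R : realType) (S : set T) :
  0 <= counting S :> \bar R.
Proof. by rewrite /counting; case: ifPn => _; rewrite ?lee_fin// leey. Qed.

(** The cardinality is the number of integers [k] such that there are more than [k]
points; this writes it as a series of indicator functions. *)
Lemma counting_atleast (T : choiceType) (R : realType) (S : set T) :
  counting S = \sum_(k <oo) (\1_[set k | atleast k.+1 S] k)%:E :> \bar R.
Proof.
transitivity (counting [set k | atleast k.+1 S] : \bar R); last exact: counting_dirac.
have [fS|infS] := pselect (finite_set S).
  rewrite (_ : [set k | _] = `I_(#|` fset_set S|)%fset).
    rewrite /counting !asboolT//. 
    by rewrite (@card_fset_set _ _ (#|` fset_set S|)%fset)//.
  apply/seteqP; split=> [k [s [us ss hs]]|k /= kS].
    rewrite /= -ss; apply: uniq_leq_size => // g /hs Sg.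
    by rewrite in_fset_set// inE.
  exists (take k.+1 (enum_fset (fset_set S))); split.
  - exact/take_uniq/fset_uniq.
  - by rewrite size_takel.
  - by move=> g /mem_take; rewrite in_fset_set// inE.
rewrite (_ : [set k | _] = setT); first by rewrite /counting !asboolF//; exact: infinite_nat.
apply/seteqP; split=> // k _ /=.
have [X XS cX] := infinite_set_fset k.+1 infS.
exists (take k.+1 (enum_fset X)); split.
- exact/take_uniq/fset_uniq.
- by rewrite size_takel.
- by move=> g /mem_take; exact: XS.
Qed.

(** Distinct points are separated by the base: one of [k + 1] points lies in a base
element that avoids the other [k].  This makes the statement that a section
has many points a countable combination of projections. *)
Lemma atleastS (G : topologicalType) (U : nat -> set G) (S : set G) k :
  hausdorff_space G ->
  (forall x V, nbhs x V -> exists n, U n x /\ U n `<=` V) ->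
  atleast k.+1 S <-> exists n, (exists g, S g /\ U n g) /\ atleast k (S `\` U n).
Proof.
move=> hG hU; split.
  move=> [[|g s] []// /andP[gs us] [ss] hs].
  have : nbhs g (~` [set` s]).
    apply: open_nbhs_nbhs; split; last by apply/negP.
    apply: closed_openC.
    have /accessible_finite_set_closed := hausdorff_accessible hG.
    by apply; exact: finite_seq.
  move=> /hU[n [Ung Us]]; exists n; split.
    by exists g; split=> //; apply: hs; rewrite mem_head.
  exists s; split=> // h sh; split; first by apply: hs; rewrite in_cons sh orbT.
  by move=> /Us; exact.
move=> [n [[g [Sg Ug]] [s [us ss hs]]]]; exists (g :: s); split=> /=.
- rewrite us andbT; apply/negP => /hs[_]; exact.
- by rewrite ss.
- by move=> h; rewrite in_cons => /predU1P[->//|/hs[]].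
Qed.

Section integral_nonmeasurable.
Context d (Z : measurableType d) (R : realType) (la : {measure set Z -> \bar R}).
Implicit Types f : Z -> \bar R.

(** For a nonnegative function that is not assumed measurable, the integral is the
supremum of the integrals of the simple functions below it. *)
Lemma ge0_le_lower_integral f g : (forall z, 0 <= f z) -> (forall z, f z <= g z) ->
  \int[la]_z f z <= \int[la]_z g z.
Proof.
move=> f0 fg; rewrite !ge0_integralTE//; last by move=> z; exact: le_trans (fg z).
apply: le_ereal_sup => _ [h hf <-]; exists h => // z.
exact: le_trans (hf z) (fg z).
Qed.

(** Setting a measurable version equal to 0, or to [+oo], on the exceptional null
set brackets the function between two measurable ones with equal integrals. *)
Lemma ae_eq_lower_integral f f' N : (forall z, 0 <= f z) -> (forall z, 0 <= f' z) ->
  measurable_fun setT f' -> measurable N -> la N = 0 ->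
  (forall z, ~ N z -> f z = f' z) -> \int[la]_z f z = \int[la]_z f' z.
Proof.
move=> f0 f'0 mf' mN N0 ff'.
have mlow : measurable_fun setT (f' \_ (~` N)).
  apply/(measurable_restrictT _ _).1; first exact: measurableC.
  exact: measurable_funS mf'.
have mup : measurable_fun setT (fun z => (f' \_ (~` N)) z + ((cst +oo) \_ N) z).
  apply: emeasurable_funD => //.
  by apply/(measurable_restrictT _ _).1.
have low0 z : 0 <= (f' \_ (~` N)) z by apply: erestrict_ge0.
have up0 z : 0 <= ((cst +oo : Z -> \bar R) \_ N) z.
  by apply: erestrict_ge0 => ? _; exact: leey.
have aelow z : ~ N z -> (f' \_ (~` N)) z = f' z.
  by move=> nN; rewrite patchE mem_set.
apply/eqP; rewrite eq_le; apply/andP; split.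
  rewrite (_ : \int[la]_z f' z =
      \int[la]_z ((f' \_ (~` N)) z + ((cst +oo) \_ N) z)).
    apply: ge0_le_lower_integral => // z; have [Nz|nN] := pselect (N z).
      by rewrite [X in _ + X]patchE mem_set//= addey ?leey// -ltNye (lt_le_trans _ (low0 z)).
    by rewrite ff'// [X in X + _]aelow// [X in _ + X]patchE memNset// adde0.
  apply: ge0_ae_eq_integral => //; first by move=> z _; exact: adde_ge0.
  exists N; split=> // z /= /not_implyP[_ h]; apply: contrapT => nN; apply: h.
  by rewrite aelow// patchE memNset// adde0.
rewrite (_ : \int[la]_z f' z = \int[la]_z (f' \_ (~` N)) z).
  apply: ge0_le_lower_integral => // z; have [Nz|nN] := pselect (N z).
    by rewrite patchE memNset//; exact.
  by rewrite aelow// ff'.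
apply: ge0_ae_eq_integral => //.
exists N; split=> // z /= /not_implyP[_ h]; apply: contrapT => nN; apply: h.
by rewrite aelow.
Qed.

(** These functions have a nonnegative measurable version.  The lower integral is
additive on them, though not in general. *)
Definition ae_mfun f := exists f' N, [/\ measurable_fun setT f',
  forall z, 0 <= f' z, measurable N, la N = 0 & forall z, ~ N z -> f z = f' z].

Lemma ae_integral_eq0 f : (forall z, 0 <= f z) -> ae_mfun f ->
  \int[la]_z f z = 0 -> \forall z \ae la, f z = 0.
Proof.
move=> f0 [f' [N [mf' f'0 mN N0 ff']]].
rewrite (ae_eq_lower_integral f0 f'0 mf' mN N0 ff') => int0.
have : ae_eq la setT f' (cst 0).
  apply/ae_eq_integral_abs => //; rewrite -[RHS]int0.
  by apply: eq_integral => z _; rewrite gee0_abs.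
move=> ae0; have aeN : \forall z \ae la, ~ N z.
  by exists N; split=> // z /= /contrapT.
apply: filterS2 ae0 aeN => z /= f'z nN; rewrite ff'//; exact: f'z.
Qed.

Lemma ae_mfunD f g : ae_mfun f -> ae_mfun g -> ae_mfun (fun z => f z + g z).
Proof.
move=> [f' [N [mf' f'0 mN N0 ff']]] [g' [M [mg' g'0 mM M0 gg']]].
exists (fun z => f' z + g' z), (N `|` M); split.
- exact: emeasurable_funD.
- by move=> z; exact: adde_ge0.
- exact: measurableU.
- apply/negligibleP; first exact: measurableU.
  by apply: negligibleU; exact/negligibleP.
- by move=> z /not_orP[nN nM]; rewrite ff'// gg'.
Qed.

Lemma ae_integralD f g : (forall z, 0 <= f z) -> (forall z, 0 <= g z) ->
  ae_mfun f -> ae_mfun g ->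
  \int[la]_z (f z + g z) = \int[la]_z f z + \int[la]_z g z.
Proof.
move=> f0 g0 [f' [N [mf' f'0 mN N0 ff']]] [g' [M [mg' g'0 mM M0 gg']]].
have mNM : measurable (N `|` M) by exact: measurableU.
rewrite (@ae_eq_lower_integral (fun z => f z + g z) (fun z => f' z + g' z) (N `|` M))//.
- rewrite ge0_integralD//; congr (_ + _); apply/esym.
    exact: (ae_eq_lower_integral _ _ _ mN).
  exact: (ae_eq_lower_integral _ _ _ mM).
- by move=> z; exact: adde_ge0.
- by move=> z; exact: adde_ge0.
- exact: emeasurable_funD.
- apply/negligibleP => //; by apply: negligibleU; exact/negligibleP.
- by move=> z /not_orP[nN nM]; rewrite ff'// gg'.
Qed.

Lemma ae_integralZ f (c : R) : (0 <= c)%R -> (forall z, 0 <= f z) -> ae_mfun f ->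
  \int[la]_z (c%:E * f z) = c%:E * \int[la]_z f z.
Proof.
move=> c0 f0 [f' [N [mf' f'0 mN N0 ff']]].
rewrite (@ae_eq_lower_integral (fun z => c%:E * f z) (fun z => c%:E * f' z) N)//.
- rewrite ge0_integralZl//; congr (_ * _); apply/esym.
  exact: (ae_eq_lower_integral _ _ _ mN).
- by move=> z; rewrite mule_ge0// lee_fin.
- by move=> z; rewrite mule_ge0// lee_fin.
- exact: measurable_funeM.
- by move=> z nN; rewrite ff'.
Qed.

Lemma ae_integral_nneseries (f : nat -> Z -> \bar R) : (forall n z, 0 <= f n z) ->
  (forall n, ae_mfun (f n)) ->
  \int[la]_z (\sum_(n <oo) f n z) = \sum_(n <oo) \int[la]_z f n z.
Proof.
move=> f0 /choice[f' /choice[N h]].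
have mf' n : measurable_fun setT (f' n) by have [] := h n.
have f'0 n z : 0 <= f' n z by have [] := h n.
have mN n : measurable (N n) by have [] := h n.
have N0 n : la (N n) = 0 by have [] := h n.
have ff' n z : ~ N n z -> f n z = f' n z by have [] := h n; move=> _ _ _ _; exact.
rewrite (@ae_eq_lower_integral _ (fun z => \sum_(n <oo) f' n z) (\bigcup_n N n)).
- rewrite integral_nneseries//; apply: eq_eseriesr => n _; apply/esym.
  exact: (ae_eq_lower_integral (f0 n) (f'0 n) (mf' n) (mN n) (N0 n) (ff' n)).
- by move=> z; apply: nneseries_ge0 => n _ _.
- by move=> z; apply: nneseries_ge0 => n _ _.
- exact: ge0_emeasurable_sum.
- exact: bigcupT_measurable.
- apply/negligibleP; first exact: bigcupT_measurable.
  by apply: negligible_bigcup => n; apply/negligibleP; [exact: mN|exact: N0].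
- move=> z nN; apply: eq_eseriesr => n _; apply: ff' => Nn; apply: nN.
  by exists n.
Qed.

End integral_nonmeasurable.

Section counting.
Context (G : topologicalGroupType) (lcG : lcsc G) d (Z : measurableType d).
Context (R : realType) (la : {measure set Z -> \bar R}).

Lemma ae_measurable_atleast (B : set (borel G * Z)) k :
  sigma_finite setT la -> measurable B ->
  ae_measurable la [set z | atleast k ([set g | B (g, z)] : set G)].
Proof.
move=> sla; have [U [oU _ hU]] := lcsc_precompact_base lcG.
have mU n : measurable (U n : set (borel G)) by apply: sub_sigma_algebra.
have [hG _ _] := lcG.
elim: k B => [|k IHk] B mB.
  rewrite (_ : [set z | _] = setT); first exact: measurable_ae.
  by apply/seteqP; split=> // z _; exists [::].
have mBU n : measurable (B `&` (fst @^-1` (U n : set (borel G)))).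
  by apply: measurableI => //; rewrite -[_ @^-1` _]setTI; exact: measurable_fst.
have mBD n : measurable (B `\` (fst @^-1` (U n : set (borel G)))).
  by apply: measurableD => //; rewrite -[_ @^-1` _]setTI; exact: measurable_fst.
rewrite (_ : [set z | _] = \bigcup_n ([set z | exists g, (B `&` (fst @^-1` U n)) (g, z)] `&`
   [set z | atleast k ([set g | (B `\` (fst @^-1` U n)) (g, z)] : set G)])).
  apply: ae_measurable_bigcup => n; apply: ae_measurableI; last exact: IHk.
  exact: ae_measurable_proj.
have hU' x V : nbhs x V -> exists n, U n x /\ U n `<=` V.
  by move=> /hU[n [Ux [K _ [UK KV]]]]; exists n; split=> //; exact: subset_trans KV.
apply/seteqP; split=> [z /(atleastS _ _ hG hU')[n [[g gS] h]]|z [n _ [[g gS] h]]].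
  by exists n => //; split=> //; exists g.
by apply/(atleastS _ _ hG hU'); exists n; split=> //; exists g.
Qed.

Lemma ae_mfun_counting (B : set (borel G * Z)) :
  sigma_finite setT la -> measurable B ->
  ae_mfun la (fun z => counting ([set g | B (g, z)] : set G)).
Proof.
move=> sla mB.
have /choice[A /choice[N h]] : forall k, ae_measurable la
    [set z | atleast k.+1 ([set g | B (g, z)] : set G)].
  by move=> k; exact: ae_measurable_atleast.
exists (fun z => \sum_(k <oo) (\1_(A k) z)%:E), (\bigcup_k N k); split.
- apply: ge0_emeasurable_sum => // k _.
  apply/measurable_EFinP; apply: measurable_indic; by have [] := h k.
- by move=> z; apply: nneseries_ge0 => n _ _; rewrite ?lee_fin.
- by apply: bigcupT_measurable => k; have [] := h k.
- apply/negligibleP; first by apply: bigcupT_measurable => k; have [] := h k.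
  apply: negligible_bigcup => k; apply/negligibleP; by have [] := h k.
- move=> z nN; rewrite counting_atleast; apply: eq_eseriesr => k _.
  have [_ _ _ hk] := h k; congr (_%:E).
  have [Nz|/hk hz] := pselect (N k z); first by exfalso; apply: nN; exists k.
  rewrite !indicE; congr (nat_of_bool _)%:R.
  by apply/idP/idP; rewrite !inE => /hz.
Qed.

End counting.

(** * The Palm measure of a cross section *)

Lemma counting_eq0 (T : choiceType) (R : realType) (S : set T) :
  counting S = 0 :> \bar R -> S = set0.
Proof.
rewrite /counting; case: ifPn => // /asboolP fS [] /eqP.
by rewrite pnatr_eq0 cardfs_eq0 => /eqP; exact: fset_set_set0.
Qed.

Lemma counting_set1 (T : choiceType) (R : realType) (x : T) :
  counting [set x] = 1 :> \bar R.
Proof. by rewrite /counting asboolT// fset_set1 cardfs1. Qed.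

Lemma esum_cst (T : choiceType) (R : realType) (S : set T) (c : R) : (0 < c)%R ->
  \esum_(i in S) c%:E = c%:E * counting S.
Proof.
move=> c0; rewrite /counting; case: ifPn => [/asboolP fS|/asboolPn nfS].
  rewrite esum_fset//; last by move=> i _; rewrite lee_fin ltW.
  rewrite fsbig_finite//= sumEFin -EFinM; congr (_%:E).
  by rewrite big_const_seq count_predT iter_addr addr0 mulr_natr.
rewrite gt0_muley ?lte_fin//; apply/eqyP => M M0.
have [k hk] : exists k : nat, (M <= k%:R * c)%R.
  exists (Num.truncn (M / c)).+1; rewrite -ler_pdivrMr//; exact/ltW/truncnS_gt.
have [X XS kX] := infinite_set_fset k nfS.
apply: (@le_trans _ _ (\sum_(i \in [set` X]) c%:E)); last first.
  by apply: ereal_sup_ubound; exists [set` X] => //; split=> //; exact: finite_fset.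
rewrite fsbig_finite//= set_fsetK sumEFin lee_fin big_const_seq count_predT iter_addr addr0.
rewrite -mulr_natl; apply: le_trans hk _.
by rewrite ler_pM2r// ler_nat.
Qed.

Lemma compact_measurable (G : topologicalGroupType) (K : set G) :
  hausdorff_space G -> compact K -> measurable (K : set (borel G)).
Proof.
move=> hG cK; rewrite -[K]setCK; apply: measurableC.
apply: sub_sigma_algebra; apply: closed_openC; exact: compact_closed.
Qed.

Section palm.
Context {G : topologicalGroupType} (lcG : lcsc G) {R : realType}.
Context {d} {Z : measurableType d} (a : G -> Z -> Z) (ha : borel_action a).
Variables (T : set Z) (mT : measurable T).
Variable la : {measure set Z -> \bar R}.

(** The return times [g] of [x] to [T] that are marked by [D] together with the
point [a g x] reached. *)
Definition returns (D : set (borel G * Z)) (x : Z) : set G :=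
  [set g | T (a g x) /\ D (g, a g x)].

Lemma measurable_returns D : measurable D ->
  measurable [set p : borel G * Z | returns D p.2 p.1].
Proof.
move=> mD; have ma := act_measurable ha.
have mga : measurable_fun setT (fun p : borel G * Z => (p.1, a p.1 p.2) : borel G * Z).
  exact/measurable_fun_pair.
rewrite (_ : [set p | _] = ((fun p : borel G * Z => a p.1 p.2) @^-1` T) `&`
   ((fun p : borel G * Z => (p.1, a p.1 p.2) : borel G * Z) @^-1` D))//.
by apply: measurableI; rewrite -[_ @^-1` _]setTI; [exact: ma|exact: mga].
Qed.

Hypothesis sla : sigma_finite setT la.

Lemma ae_mfun_returns D : measurable D ->
  ae_mfun la (fun x => counting (returns D x)).
Proof. by move=> mD; apply: ae_mfun_counting sla (measurable_returns mD). Qed.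

(** Sigma-additivity comes from that of the counting measure, integrated term by
term. *)
Lemma palm_measure : exists Q : {measure set (borel G * Z) -> \bar R},
  forall D, Q D = \int[la]_x counting (returns D x).
Proof.
pose Q0 (D : set (borel G * Z)) := \int[la]_x counting (returns D x).
have Q00 : Q0 set0 = 0.
  rewrite /Q0 -[RHS](integral0 la setT); apply: eq_integral => x _.
  rewrite (_ : returns _ _ = set0) ?/counting ?asboolT ?fset_set0//.
  by apply/seteqP; split=> [g []|].
have Q0ge0 D : 0 <= Q0 D.
  by apply: integral_ge0 => x _; exact: counting_ge0.
have Q0sigma : semi_sigma_additive Q0.
  move=> F mF tF mUF.
  have -> : Q0 (\bigcup_n F n) = \sum_(n <oo) Q0 (F n).
    rewrite -ae_integral_nneseries.
    - apply: eq_integral => x _.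
      have -> : returns (\bigcup_n F n) x = \bigcup_n returns (F n) x.
        apply/seteqP; split=> [g [Tg [n _ Fg]]|g [n _ [Tg Fg]]].
          by exists n.
        exact: (conj Tg (ex_intro2 _ _ n I Fg)).
      have mR n : measurable (returns (F n) x : set (borel G)).
        rewrite (_ : returns _ _ = ysection [set p | returns (F n) p.2 p.1] x).
          exact: measurable_ysection (measurable_returns (mF n)).
        by apply/seteqP; split=> g; rewrite /ysection/= inE.
      apply: (@measure_semi_bigcup _ _ _ (@counting (borel G) R)) => //.
        move=> i j _ _ [g [[_ Fi] [_ Fj]]].
        by apply: tF => //; exists (g, a g x).
      exact: bigcupT_measurable.
    - by move=> n x; exact: counting_ge0.
    - by move=> n; exact: ae_mfun_returns.
  by apply: is_cvg_nneseries => n _ _.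
pose mQ := isMeasure.Build _ _ _ Q0 Q00 Q0ge0 Q0sigma.
pose Q : {measure set (borel G * Z) -> \bar R} := HB.pack Q0 mQ.
by exists Q.
Qed.

Variable mG : {measure set (borel G) -> \bar R}.
Hypothesis hmG : haar_measure mG.
Variable muT : {measure set Z -> \bar R}.
Hypothesis hmuT : transverse_measure mG a la T muT.
Variable Q : {measure set (borel G * Z) -> \bar R}.
Hypothesis hQ : forall D, Q D = \int[la]_x counting (returns D x).

(** The weight [w = (\1_A1 + \1_A2) / s] has integral 1 and turns the defining formula
of the transverse measure into a count of return times.  Two sets are handled
together so that one of them may be null for Haar measure. *)
Lemma palm_rect_pair (A1 A2 : set (borel G)) (E : set Z) (s : R) :
  measurable A1 -> measurable A2 -> measurable E ->
  (0 < s)%R -> mG A1 + mG A2 = s%:E ->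
  Q (A1 `*` E) + Q (A2 `*` E) = s%:E * muT E.
Proof.
move=> mA1 mA2 mE s0 As; have [muTC hT] := hmuT.
pose c := (s^-1)%R; have c0 : (0 < c)%R by rewrite invr_gt0.
pose w g : \bar R := c%:E * (\1_A1 g)%:E + c%:E * (\1_A2 g)%:E.
have c10 (A : set (borel G)) g : 0 <= c%:E * (\1_A g)%:E.
  by rewrite mule_ge0// lee_fin// ltW.
have mc1 (A : set (borel G)) :
    measurable A -> measurable_fun setT (fun g => c%:E * (\1_A g)%:E).
  by move=> mA; apply: measurable_funeM; exact/measurable_EFinP.
have mw : measurable_fun setT w by apply: emeasurable_funD; exact: mc1.
have w0 g : 0 <= w g by exact: adde_ge0.
have ic1 (A : set (borel G)) : measurable A ->
    \int[mG]_g (c%:E * (\1_A g)%:E) = c%:E * mG A.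
  move=> mA; rewrite (@ge0_integralZl_EFin _ _ _ mG setT measurableT (fun g => (\1_A g)%:E) _ _ c (ltW c0)).
  - by rewrite integral_indic// setIT.
  - by move=> g _; rewrite lee_fin.
  - exact/measurable_EFinP.
have w1 : \int[mG]_g w g = 1.
  rewrite ge0_integralD//; [|exact: mc1|exact: mc1].
  rewrite !ic1// -ge0_muleDr// As -EFinM mulVf// gt_eqF//.
have := hT w (fun x => (\1_E x)%:E) mw w0 w1.
have -> : \int[muT]_(y in T) (\1_E y)%:E = muT E.
  rewrite integral_indic// [RHS](measureDI muT mE mT).
  rewrite [X in _ = X + _](_ : _ = 0) ?add0e//.
  apply: subset_measure0 muTC; first exact: measurableD.
    exact: measurableC.
  by move=> x [].
have ecst (A : set (borel G)) x :
    (\esum_(g in hitting a T x) (if g \in [set g : G | (A `*` E) (g, a g x)] then c%:E else 0)) =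
    c%:E * counting (returns (A `*` E) x).
  by rewrite -esum_mkcondr esum_cst.
have -> : \int[la]_x (\esum_(g in hitting a T x) ((\1_E (a g x))%:E * w g)) =
   c%:E * (Q (A1 `*` E) + Q (A2 `*` E)).
  have c00 D x : 0 <= counting (returns D x) :> \bar R.
    exact: counting_ge0.
  have mAE (A : set (borel G)) : measurable A -> measurable (A `*` E).
    by move=> mA; exact: measurableX.
  rewrite !hQ -ae_integralD//; try exact: ae_mfun_returns (mAE _ _).
  rewrite -ae_integralZ ?ltW//; last 2 first.
  - by move=> z; exact: adde_ge0.
  - by apply: ae_mfunD; exact: ae_mfun_returns (mAE _ _).
  apply: eq_integral => x _; rewrite ge0_muleDr// -!ecst -esumD.
  - apply: eq_esum => g _; rewrite /w ge0_muleDr//.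
    have ind (A : set (borel G)) : (\1_E (a g x))%:E * (c%:E * (\1_A g)%:E) =
        if g \in [set g : G | (A `*` E) (g, a g x)] then c%:E else 0.
      rewrite !indicE; case: ifPn; rewrite ?inE ?notin_setE => hg.
        by case: hg => /= Ag Eg; rewrite !mem_set// mul1e mule1.
      have [Ag|nA] := pselect (A g); last by rewrite [in X in _ * X]memNset// !mule0.
      by rewrite memNset ?mul0e// => Eg; apply: hg.
    by rewrite !ind.
  - by move=> g _; case: ifP => // _; rewrite lee_fin ltW.
  - by move=> g _; case: ifP => // _; rewrite lee_fin ltW.
move=> -> //; last exact/measurable_funTS/measurable_EFinP.
by rewrite muleA -EFinM mulfV ?gt_eqF// mul1e.
Qed.

Lemma haar_compact_pos : exists K : set G,
  [/\ compact K, measurable (K : set (borel G)) & 0 < mG K < +oo].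
Proof.
have [hG _ _] := lcG.
have [K [cK KT]] := open_sigma_compact lcG (@openT G).
apply: contrapT => /forallNP h; have := haar_neq0 hmG; apply/negP; rewrite negbK.
have mK n : measurable (K n : set (borel G)) by exact: compact_measurable.
rewrite [X in mG X](_ : _ = \bigcup_n K n)//; apply/eqP/negligibleP.
  exact: bigcupT_measurable.
apply: negligible_bigcup => n; apply/negligibleP => //.
apply/eqP; apply: contrapT => /negP K0; apply: (h (K n)); split=> //.
by rewrite lt0e K0 measure_ge0/= (haar_compact hmG).
Qed.

(** The Palm measure is the product of Haar measure and the transverse measure.  A
weight supported by [A] alone exists only if [A] has positive measure; adding
to [A] a compact set [K] of positive measure and subtracting the formula for
[K] covers null sets as well. *)
Lemma palm_rect (A : set (borel G)) (E : set Z) :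
  muT setT < +oo -> measurable A -> mG A < +oo -> measurable E ->
  Q (A `*` E) = mG A * muT E.
Proof.
move=> muTfin mA Afin mE; have [K [cK mK /andP[K0 Kfin]]] := haar_compact_pos.
have fK : mG K = (fine (mG K))%:E by rewrite fineK// ge0_fin_numE.
have fA : mG A = (fine (mG A))%:E by rewrite fineK// ge0_fin_numE.
have fE : muT E \is a fin_num.
  rewrite ge0_fin_numE//; apply: le_lt_trans muTfin.
  by apply: le_measure; rewrite ?inE.
have K0' : (0 < fine (mG K))%R by rewrite -lte_fin -fK.
have QK : Q (K `*` E) = mG K * muT E.
  have := @palm_rect_pair K set0 E (fine (mG K)) mK measurable0 mE K0'.
  by rewrite measure0 adde0 set0X measure0 adde0 -fK; apply.
have A0' : (0 <= fine (mG A))%R by rewrite -lee_fin -fA.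
have ltAK : (0 < fine (mG A) + fine (mG K))%R by rewrite ltr_wpDl.
have := palm_rect_pair mA mK mE ltAK; rewrite EFinD -fA -fK QK => /(_ erefl).
rewrite fA fK -(fineK fE) -EFinD -!EFinM.
by case: (Q (A `*` E)) => [q| |]// [] /eqP; rewrite mulrDl (inj_eq (addIr _)) => /eqP ->.
Qed.

Lemma palm_null D : measurable D -> Q D = 0 ->
  \forall x \ae la, forall g, T (a g x) -> ~ D (g, a g x).
Proof.
rewrite hQ => mD /(ae_integral_eq0 _ (ae_mfun_returns mD)) ae0.
have c00 x : 0 <= counting (returns D x) :> \bar R.
  exact: counting_ge0.
apply: filterS (ae0 c00) => x /counting_eq0 h g Tg Dg.
by have : returns D x g by []; rewrite h.
Qed.

Lemma transverse_null (E : set Z) : muT setT < +oo -> measurable E -> muT E = 0 ->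
  \forall x \ae la, forall g, T (a g x) -> ~ E (a g x).
Proof.
move=> muTfin mE E0; have [hG _ _] := lcG.
have [K [cK KT]] := open_sigma_compact lcG (@openT G).
have mK n : measurable (K n : set (borel G)) by exact: compact_measurable.
have QE : Q (setT `*` E) = 0.
  rewrite KT setX_bigcupl; apply/negligibleP.
    by apply: bigcupT_measurable => n; exact: measurableX.
  apply: negligible_bigcup => n; apply/negligibleP; first exact: measurableX.
  apply: etrans (palm_rect muTfin (mK n) (haar_compact hmG (cK n)) mE) _.
  by rewrite E0 mule0.
by apply: filterS (palm_null (measurableX measurableT mE) QE) => x h g Tg Eg;
  exact: (h g Tg).
Qed.

End palm.

(** * Coding locally finite sets, and the lexicographic order *)

(** A locally finite set is coded by the base elements that it meets, hence by a
point of the Borel space of binary sequences. *)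
Definition trace_cylinders : set (set (nat -> bool)) :=
  [set A | exists n, A = [set c : nat -> bool | c n]].

Definition traces := g_sigma_algebraType trace_cylinders.

Lemma measurable_trace_coord n : measurable [set c : traces | c n].
Proof. by apply: sub_sigma_algebra; exists n. Qed.

Section code.
Context {G : topologicalType} (U : nat -> set G) (bU : precompact_base U).

Definition code (S : set G) : traces := fun n => `[< exists2 g, S g & U n g >].

Definition decode (c : traces) : set G := [set g | forall n, U n g -> c n].

(** A point outside a locally finite set has a neighbourhood that misses the set, and
a base element inside that neighbourhood detects it. *)
Lemma decode_code (S : set G) : hausdorff_space G ->
  (forall K, compact K -> finite_set (S `&` K)) -> decode (code S) = S.
Proof.
have [oU cU nU] := bU.
move=> hG fS; apply/seteqP; split=> [g hg|g Sg n Ug]; last by apply/asboolP; exists g.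
apply: contrapT => nSg.
have [n [Ung [K cK [UK _]]]] := nU g setT filterT.
have clF : closed (S `&` K).
  by have /accessible_finite_set_closed := hausdorff_accessible hG; apply; exact: fS.
have gV : nbhs g (U n `&` ~` (S `&` K)).
  apply: filterI; first exact: open_nbhs_nbhs.
  by apply: open_nbhs_nbhs; split; [exact: closed_openC|case].
have [k [Ukg [L _ [UL LV]]]] := nU _ _ gV.
have /asboolP[h Sh /UL/LV[Unh]] := hg k Ukg; apply; split=> //.
exact: UK.
Qed.

(** The order of first difference of the sequences [n |-> U n g], where belonging to
[U n] comes first.  It is Borel, and every nonempty locally finite set has a
least element for it. *)
Definition lexlt (h g : G) := exists n,
  [/\ U n h, ~ U n g & forall k, (k < n)%N -> (U k h <-> U k g)].

Lemma lexlt_total h g : hausdorff_space G -> h <> g -> lexlt h g \/ lexlt g h.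
Proof.
have [oU cU nU] := bU.
move=> hG hg.
pose P n := `[< ~ (U n h <-> U n g) >].
have exP : exists n, P n.
  have : nbhs h (~` [set g]).
    apply: open_nbhs_nbhs; split; last exact.
    apply: closed_openC.
    by have /accessible_finite_set_closed := hausdorff_accessible hG; apply.
  move=> /nU[n [Unh [K _ [UK Kg]]]]; exists n; apply/asboolP => -[/(_ Unh) Ung _].
  exact: (Kg g (UK _ Ung)).
case: (ex_minnP exP) => n /asboolP Pn nmin.
have agr k : (k < n)%N -> (U k h <-> U k g).
  move=> ltkn; apply: contrapT => nk.
  by have := nmin k (asboolT nk); rewrite leqNgt ltkn.
have [Unh|nUnh] := pselect (U n h).
  by left; exists n; split=> // Ung; apply: Pn; split.
right; exists n; split=> //; last by move=> k /agr; tauto.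
by apply: contrapT => nUng; apply: Pn; split.
Qed.

Lemma lexlt_trans : forall x y z, lexlt x y -> lexlt y z -> lexlt x z.
Proof.
move=> x y z [n [Ux nUy xy]] [m [Uy nUz yz]].
have [ltnm|] := ltnP n m.
  exists n; split=> // [/yz|k ltkn]; [by move=> /(_ ltnm)|].
  by rewrite xy// yz//; exact: ltn_trans ltnm.
rewrite leq_eqVlt => /predU1P[mn|ltmn]; first by rewrite mn in Uy.
exists m; split=> // [|k ltkm]; first by apply/xy.
by rewrite xy ?yz//; exact: ltn_trans ltmn.
Qed.

Lemma lexlt_irr x : ~ lexlt x x.
Proof. by move=> [n []]. Qed.

(** Let [n] be the first index such that [S] meets [U n].  Points of [S] in [U n]
precede all others, and they are finitely many because [U n] is precompact. *)
Lemma lexlt_min (S : set G) : hausdorff_space G ->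
  (forall K, compact K -> finite_set (S `&` K)) -> S !=set0 ->
  exists2 g, S g & forall h, S h -> ~ lexlt h g.
Proof.
move=> hG fS [g0 Sg0]; have [oU cU nU] := bU.
pose P n := `[< exists2 g, S g & U n g >].
have exP : exists n, P n.
  by have [n [Un _]] := nU g0 setT filterT; exists n; apply/asboolP; exists g0.
case: (ex_minnP exP) => n /asboolP[g1 Sg1 Ug1] nmin.
have miss k g : (k < n)%N -> S g -> ~ U k g.
  move=> ltkn Sg Ug; have := nmin k.
  by rewrite leqNgt ltkn => /(_ _)/negP; apply=> //; apply/asboolP; exists g.
have [K cK UK] := cU n.
have fF : finite_set (S `&` U n).
  by apply: sub_finite_set (fS K cK) => g [Sg /UK].
have [g [Sg Ug] hg] : exists2 g, (S `&` U n) g & forall h, (S `&` U n) h -> ~ lexlt h g.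
  have : (S `&` U n) g1 by [].
  have /finite_seqP[s ->] := fF.
  elim: s g1 {Sg1 Ug1} => [//|x s IHs] g1 _.
  case: s IHs => [_|y s IHs].
    exists x; first exact: mem_head.
    by move=> h /=; rewrite inE => /eqP ->; exact: lexlt_irr.
  have [g sg hg] := IHs y (mem_head _ _).
  have [xg|nxg] := pselect (lexlt x g).
    exists x; first exact: mem_head.
    move=> h /=; rewrite in_cons => /predU1P[->|/hg nhg hx]; first exact: lexlt_irr.
    by apply: nhg; exact: lexlt_trans xg.
  exists g; first by rewrite /= in_cons; apply/orP; right.
  by move=> h /=; rewrite in_cons => /predU1P[->//|/hg].
exists g => // h Sh; have [Uh|nUh] := pselect (U n h); first exact: hg.
move=> [k [Ukh nUkg kk]]; have [ltkn|] := ltnP k n; first exact: (miss k h).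
rewrite leq_eqVlt => /predU1P[nk|ltnk]; first by rewrite -nk in Ukh.
by apply: nUh; apply/kk.
Qed.

End code.

Section mul_measurable.
Context (G : topologicalGroupType) (lcG : lcsc G).

(** The inverse image of an open set is a countable union of rectangles of base
elements, hence lies in the product of the Borel sigma-algebras. *)
Lemma measurable_mulg :
  measurable_fun setT (fun p : borel G * borel G => (p.1 * p.2)%g : borel G).
Proof.
have [U [oU _ hU]] := lcsc_precompact_base lcG.
have mU n : measurable (U n : set (borel G)) by apply: sub_sigma_algebra.
apply: (@measurability _ _ (borel G * borel G)%type (borel G) setT _ (@open G : set (set (borel G)))); first by [].
move=> _ [W oW <-]; rewrite setTI.
pose V ij := if `[< forall x y, U ij.1 x -> U ij.2 y -> W (x * y)%g >]
             then (U ij.1 : set (borel G)) `*` (U ij.2 : set (borel G)) else set0.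
rewrite (_ : _ @^-1` _ = \bigcup_i \bigcup_j V (i, j)); last first.
  apply/seteqP; split=> [[x y]/= Wxy|[x y] [i _ [j _]]]; last first.
    by rewrite /V; case: asboolP => //= h [/=]; exact: h.
  have := @mulg_continuous G (x, y) _ (open_nbhs_nbhs (conj oW Wxy)).
  move=> [[A B] /= [xA yB] AB].
  have [i [Ux [K _ [UK KA]]]] := hU _ _ xA.
  have [j [Uy [L _ [UL LB]]]] := hU _ _ yB.
  exists i => //; exists j => //; rewrite /V asboolT//= => u v Uu Uv.
  by apply: (AB (u, v)); split; [exact/KA/UK|exact/LB/UL].
apply: bigcupT_measurable => i; apply: bigcupT_measurable => j.
by rewrite /V; case: ifP => _; [exact: measurableX|exact: measurable0].
Qed.

End mul_measurable.

(** * The law of the return times *)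

Lemma fin_sigma_finite d (Z : measurableType d) (R : realType)
    (la : {measure set Z -> \bar R}) : la setT < +oo -> sigma_finite setT la.
Proof.
by move=> fla; exists (fun=> setT) => [|n]; [rewrite bigcup_const//; exists 0%N|].
Qed.

Section trace_map.
Context {G : topologicalGroupType} (lcG : lcsc G) (U : nat -> set G).
Hypothesis bU : precompact_base U.
Context {R : realType} {d} {Z : measurableType d} (a : G -> Z -> Z).
Hypothesis ha : borel_action a.
Variables (Y : set Z) (mY : measurable Y) (la : {measure set Z -> \bar R}).
Hypothesis sla : sigma_finite setT la.

Lemma measurable_base n : measurable (U n : set (borel G)).
Proof. by have [oU _ _] := bU; apply: sub_sigma_algebra. Qed.

(** Each coordinate of the code asks whether a Borel set has a nonempty section, so
it has a measurable version by the projection theorem. *)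
Lemma trace_map : exists theta : Z -> traces, exists N : set Z,
  [/\ measurable_fun setT theta, measurable N, la N = 0 &
      forall x, ~ N x -> theta x = code U (hitting a Y x)].
Proof.
have /choice[A /choice[N h]] : forall n, ae_measurable la
    [set x | exists g, returns a Y ((U n : set (borel G)) `*` setT) x g].
  move=> n; apply: (ae_measurable_proj lcG
    (B := [set p | returns a Y ((U n : set (borel G)) `*` setT) p.2 p.1])) => //.
  apply: measurable_returns => //; apply: measurableX => //; exact: measurable_base.
exists (fun x => (fun n => `[< A n x >]) : traces), (\bigcup_n N n); split.
- apply: (@measurability _ _ Z traces setT _ trace_cylinders); first by [].
  move=> _ [_ [n ->] <-]; rewrite setTI.
  rewrite (_ : _ @^-1` _ = A n); first by have [] := h n.
  by apply/seteqP; split=> x /asboolP.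
- by apply: bigcupT_measurable => n; have [] := h n.
- apply/negligibleP; first by apply: bigcupT_measurable => n; have [] := h n.
  by apply: negligible_bigcup => n; apply/negligibleP; have [] := h n.
- move=> x nN; apply/funext => n; apply/asbool_equiv_eq.
  have [_ _ _ hn] := h n; rewrite -hn; last by move=> Nx; apply: nN; exists n.
  by split=> [[g [Yg [Ug _]]]|[g Yg Ug]]; exists g.
Qed.

End trace_map.

Lemma hittingM (G : topologicalGroupType) d (Z : measurableType d)
    (a : G -> Z -> Z) (Y : set Z) g x : borel_action a ->
  hitting a Y (a g x) = [set h | hitting a Y x (h * g)%g].
Proof. by move=> ha; apply/seteqP; split=> h /=; rewrite /hitting/= (actM ha). Qed.

Lemma ae_mfun_congr d (Z : measurableType d) (R : realType)
    (la : {measure set Z -> \bar R}) (f g : Z -> \bar R) :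
  (forall z, 0 <= f z) -> (forall z, 0 <= g z) ->
  ae_mfun la f -> (\forall z \ae la, f z = g z) ->
  ae_mfun la g /\ \int[la]_z f z = \int[la]_z g z.
Proof.
move=> f0 g0 [f' [N [mf' f'0 mN N0 ff']]] [M [mM M0 fg]].
have mNM : measurable (N `|` M) by exact: measurableU.
have NM0 : la (N `|` M) = 0.
  by apply/negligibleP => //; apply: negligibleU; exact/negligibleP.
have gf' z : ~ (N `|` M) z -> g z = f' z.
  move=> /not_orP[nN nM]; rewrite -ff'//; apply/esym.
  by apply: contrapT => nfg; apply: nM; exact: fg.
split; first by exists f', (N `|` M).
rewrite (ae_eq_lower_integral f0 f'0 mf' mN N0 ff').
by rewrite (ae_eq_lower_integral g0 f'0 mf' mNM NM0 gf').
Qed.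

(** The number of points [g] of [S] in [K] such that [S], translated so that [g]
becomes the identity, has its code in [E].  It involves return times only:
for [S = hitting a Y x] the translate is [hitting a Y (a g x)]. *)
Definition local_stat {R : realType} {G : topologicalGroupType} (U : nat -> set G)
    (K : set G) (E : set traces) (S : set G) : \bar R :=
  counting [set g : G | [/\ S g, K g & E (code U [set h | S (h * g)%g])]].

Section law.
Context {G : topologicalGroupType} (lcG : lcsc G) (U : nat -> set G).
Hypothesis bU : precompact_base U.
Context {R : realType} {d} {Z : measurableType d} (a : G -> Z -> Z).
Hypothesis ha : borel_action a.
Variables (Y : set Z) (mY : measurable Y) (mu : {measure set Z -> \bar R}).
Hypothesis smu : sigma_finite setT mu.
Variable mG : {measure set (borel G) -> \bar R}.
Hypothesis hmG : haar_measure mG.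
Variable muY : {measure set Z -> \bar R}.
Hypothesis hmuY : transverse_measure mG a mu Y muY.
Hypothesis muYfin : muY setT < +oo.
Variables (theta : Z -> traces) (N : set Z).
Hypotheses (mtheta : measurable_fun setT theta) (mN : measurable N).
Hypotheses (N0 : muY N = 0)
  (thetaE : forall x, ~ N x -> theta x = code U (hitting a Y x)).

(** Points of [Y] with a wrong code form a [muY]-null set, so almost no orbit visits
them; the Palm formula for the rectangle of [K] and [theta @^-1` E] then counts
return times by their true codes. *)
Lemma local_stat_law (K : set (borel G)) (E : set traces) :
  measurable K -> mG K < +oo -> measurable E ->
  ae_mfun mu (fun x => local_stat U K E (hitting a Y x)) /\
  mG K * muY (theta @^-1` E) = \int[mu]_x local_stat U K E (hitting a Y x).
Proof.
move=> mK Kfin mE; have [Q hQ] := palm_measure lcG ha mY smu.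
have mtE : measurable (theta @^-1` E) by rewrite -[_ @^-1` _]setTI; exact: mtheta.
rewrite -(palm_rect lcG ha mY smu hmG hmuY hQ muYfin mK Kfin mtE) hQ.
apply: ae_mfun_congr.
- by move=> x; exact: counting_ge0.
- by move=> x; exact: counting_ge0.
- exact: (ae_mfun_returns lcG ha mY smu (measurableX mK mtE)).
apply: filterS (transverse_null lcG ha mY smu hmG hmuY hQ muYfin mN N0) => x hx.
congr counting; apply/seteqP; split=> g.
  by move=> [Yg [/= Kg]]; rewrite /preimage/= thetaE ?hittingM//; exact: hx.
move=> [Yg Kg Eg]; split=> //; split=> //.
by rewrite /preimage/= thetaE ?hittingM//; exact: hx.
Qed.

End law.

(** By the Palm formula the mean number of return times in a compact set [K] is
[mG K * muY setT]; take [K] of positive measure. *)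
Lemma transverse_measure_finite {G : topologicalGroupType} (lcG : lcsc G)
    {R : realType} {d} {Z : measurableType d} (a : G -> Z -> Z)
    (mu : {measure set Z -> \bar R}) (Y : set Z)
    (mG : {measure set (borel G) -> \bar R}) (muY : {measure set Z -> \bar R}) :
  borel_action a -> measurable Y -> sigma_finite setT mu -> haar_measure mG ->
  transverse_measure mG a mu Y muY ->
  (forall K : set G, compact K -> \int[mu]_x counting (hitting a Y x `&` K) < +oo) ->
  muY setT < +oo.
Proof.
move=> ha mY smu hmG hmuY lint.
have [K [cK mK /andP[K0 Kfin]]] := haar_compact_pos lcG hmG.
have [Q hQ] := palm_measure lcG ha mY smu.
have fK : mG K = (fine (mG K))%:E by rewrite fineK// ge0_fin_numE.
have K0' : (0 < fine (mG K))%R by rewrite -lte_fin -fK.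
have := palm_rect_pair lcG ha mY smu hmuY hQ mK measurable0 measurableT K0'.
rewrite measure0 adde0 set0X measure0 adde0 => /(_ fK) QK.
have : Q (K `*` setT) < +oo.
  rewrite hQ; apply: le_lt_trans (lint K cK); apply: ge0_le_lower_integral => x.
    exact: counting_ge0.
  rewrite (_ : returns _ _ _ _ = hitting a Y x `&` K)//.
  by apply/seteqP; split=> [g [Yg [Kg _]]|g [Yg Kg]].
rewrite QK; have : 0 <= muY setT by [].
case: (muY setT) => [s _ _|_|]//; first exact: ltry.
by rewrite gt0_muley ?lte_fin.
Qed.

(** A transverse factor identifies the return times of [x] with those of [phi x]
almost everywhere and carries [mu] to [nu].  The argument evaluates [phi] along [mu]
alone, never on [Y], where an almost everywhere equivariant map carries no
information since [Y] is usually [mu]-null. *)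
Lemma factor_integral_hitting {G : topologicalGroupType} {R : realType}
    {dX} {X : measurableType dX} {dW} {W : measurableType dW}
    (a : G -> X -> X) (b : G -> W -> W) (mu : probability X R)
    (nu : probability W R) (Y : set X) (Z : set W) (phi : X -> W)
    (xi : set G -> \bar R) :
  transverse_Gfactor a mu Y b nu Z phi -> (forall S, 0 <= xi S) ->
  ae_mfun mu (fun x => xi (hitting a Y x)) ->
  ae_mfun nu (fun w => xi (hitting b Z w)) ->
  \int[mu]_x xi (hitting a Y x) = \int[nu]_w xi (hitting b Z w).
Proof.
move=> [[mphi phimu _] hitE] xi0 amu [f' [N [mf' f'0 mN N0 ff']]].
rewrite (ae_eq_lower_integral (fun w => xi0 _) f'0 mf' mN N0 ff').
have [_ ->] := ae_mfun_congr (g := fun x => xi (hitting b Z (phi x)))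
  (fun x => xi0 _) (fun x => xi0 _) amu (filterS (fun x h => f_equal xi h) hitE).
have mphiN : measurable (phi @^-1` N) by rewrite -[_ @^-1` _]setTI; exact: mphi.
rewrite (ae_eq_lower_integral (f' := f' \o phi) (N := phi @^-1` N))//; last 4 first.
- by move=> x; exact: f'0.
- exact: measurableT_comp.
- exact: etrans (phimu _ mN) N0.
- by move=> x nN; exact: ff'.
have -> : \int[mu]_x (f' \o phi) x = \int[pushforward mu phi]_w f' w.
  by rewrite ge0_integral_pushforward// preimage_setT.
by apply: eq_measure_integral => A mA _; exact: phimu.
Qed.

(** * Measurability of first returns *)

Lemma ae_measurableC d (Z : measurableType d) (R : realType)
    (la : {measure set Z -> \bar R}) (A : set Z) :
  ae_measurable la A -> ae_measurable la (~` A).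
Proof.
move=> [A' [N [mA' mN N0 h]]]; exists (~` A'), N; split=> //.
  exact: measurableC.
by move=> z /h[AA' A'A]; split; apply: contra_not.
Qed.

Lemma measurable_preimage d1 d2 (T1 : measurableType d1) (T2 : measurableType d2)
    (f : T1 -> T2) (A : set T2) :
  measurable_fun setT f -> measurable A -> measurable (f @^-1` A).
Proof. by move=> mf mA; rewrite -[_ @^-1` _]setTI; exact: mf. Qed.

Lemma measurable_box d (X : measurableType d) r (E : 'I_r -> set X) :
  (forall i, measurable (E i)) -> measurable [set t : r.-tuple X | forall i, E i (tnth t i)].
Proof.
move=> mE; rewrite (_ : [set t | _] = \bigcap_(i in [set: 'I_r]) ((fun t => tnth t i) @^-1` E i)).
  apply: fin_bigcap_measurable => // i _.
  by apply: measurable_preimage (mE i); exact: measurable_tnth.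
by apply/seteqP; split=> [t h i _|t h i]; [exact: h|exact: (h i I)].
Qed.

Section first_return.
Context {G : topologicalGroupType} (lcG : lcsc G) (U : nat -> set G).
Hypothesis bU : precompact_base U.
Variable r : nat.

(** For [c] the codes of the return times of the coordinates of [y = b g t], the
return times of [t] are the products [k * g] with [k] a common return time of
the coordinates of [y]; the condition says that none of them precedes [g]. *)
Definition first_return : set (borel G * r.-tuple traces) :=
  [set p | forall k, (forall i, decode U (tnth p.2 i) k) ->
                     ~ lexlt U (k * p.1)%g p.1].

Lemma measurable_lexlt : measurable [set p : borel G * borel G | lexlt U p.1 p.2].
Proof.
have mU n : measurable (U n : set (borel G)) by exact: measurable_base.
pose A n := (fst : borel G * borel G -> borel G) @^-1` U n.
pose B n := (snd : borel G * borel G -> borel G) @^-1` U n.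
have mA n : measurable (A n) by exact: measurable_preimage measurable_fst _.
have mB n : measurable (B n) by exact: measurable_preimage measurable_snd _.
rewrite (_ : [set p | _] = \bigcup_n (A n `&` ~` B n `&`
   \bigcap_(k in `I_n) ((A k `&` B k) `|` (~` A k `&` ~` B k)))).
  apply: bigcupT_measurable => n; apply: measurableI.
    by apply: measurableI => //; exact: measurableC.
  apply: bigcap_measurableType => k _; apply: measurableU; apply: measurableI => //;
    exact: measurableC.
apply/seteqP; split=> [[h g] [n [Uh nUg hk]]|[h g] [n _ [[Uh nUg] hk]]]; exists n => //.
  by split=> // k /hk; rewrite /A /B /=; have [|] := pselect (U k h); tauto.
by split=> // k /hk; rewrite /A /B /=; tauto.
Qed.

Lemma ae_measurable_first_return (R : realType)
    (P : {measure set (borel G * r.-tuple traces) -> \bar R}) :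
  sigma_finite setT P -> ae_measurable P first_return.
Proof.
move=> sP.
pose T3 := (borel G * (borel G * r.-tuple traces))%type.
pose B : set T3 := [set q | (forall i, decode U (tnth q.2.2 i) q.1) /\
                            lexlt U (q.1 * q.2.1)%g q.2.1].
rewrite (_ : first_return = ~` [set p | exists k, B (k, p)]); last first.
  apply/seteqP; split=> [p h [k [dk lk]]|p h k dk lk]; first exact: (h k dk lk).
  by apply: h; exists k.
apply: ae_measurableC; apply: ae_measurable_proj => //.
have mU n : measurable (U n : set (borel G)) by exact: measurable_base.
pose D n i := ~` ((fst : T3 -> borel G) @^-1` U n) `|`
  (fun q : T3 => tnth q.2.2 i) @^-1` [set c : traces | c n].
pose f (q : T3) : borel G * borel G := ((q.1 * q.2.1)%g, q.2.1).
have mg : measurable_fun setT (fun q : T3 => q.2.1).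
  exact: measurableT_comp measurable_fst measurable_snd.
have mf : measurable_fun setT f.
  have mp : measurable_fun setT (fun q : T3 => (q.1, q.2.1) : borel G * borel G).
    by apply/measurable_fun_pair => //; exact: measurable_fst.
  by apply/measurable_fun_pair => //; exact: measurableT_comp (measurable_mulg lcG) mp.
rewrite (_ : B = (\bigcap_n \bigcap_(i in [set: 'I_r]) D n i) `&`
   f @^-1` [set p | lexlt U p.1 p.2]).
  apply: measurableI; last exact: measurable_preimage mf measurable_lexlt.
  apply: bigcapT_measurable => n; apply: fin_bigcap_measurable => // i _.
  apply: measurableU.
    by apply: measurableC; exact: measurable_preimage measurable_fst _.
  apply: measurable_preimage (measurable_trace_coord n).
  apply: measurableT_comp (measurable_tnth i) _.
  exact: measurableT_comp measurable_snd measurable_snd.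
apply/seteqP; split=> [q [dq lq]|q [dq lq]]; split=> //.
  move=> n _ i _; have [Uq|] := pselect (U n q.1); last by left.
  by right; exact: (dq i n Uq).
by move=> i n Uq; have [] := dq n I i I.
Qed.

End first_return.

(** Haar measure is bounded on the sides in [G], so that a measure of product type is
finite on an exhausting sequence of these boxes and hence determined by them. *)
Lemma measurable_rect_generator (G : topologicalGroupType) (lcG : lcsc G) (R : realType)
   (mG : {measure set (borel G) -> \bar R}) (hmG : haar_measure mG) r d (S : measurableType d) :
  @measurable _ (borel G * r.-tuple S)%type =
  <<s [set D | exists A : set (borel G), exists E : 'I_r -> set S,
       [/\ measurable A, mG A < +oo, forall i, measurable (E i) &
           D = A `*` [set t | forall i, E i (tnth t i)]]] >>.
Proof.
apply/seteqP; split; last first.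
  apply: smallest_sub; first exact: sigma_algebra_measurable.
  by move=> _ [A [E [mA _ mE ->]]]; apply: measurableX => //; exact: measurable_box.
set gen := [set D | _].
have sgen := smallest_sigma_algebra setT gen.
have [hG _ _] := lcG.
have [K [cK KT]] := open_sigma_compact lcG (@openT G).
have mK n : measurable (K n : set (borel G)) by exact: compact_measurable.
have Kfin n : mG (K n) < +oo by exact: haar_compact.
have rectT (A : set (borel G)) E : measurable A -> (forall i, measurable (E i)) ->
    <<s gen >> (A `*` [set t : r.-tuple S | forall i, E i (tnth t i)]).
  move=> mA mE.
  rewrite -[A]setIT KT setI_bigcupr setX_bigcupl.
  apply: sigma_algebra_bigcup => n; apply: sub_sigma_algebra.
  exists (A `&` K n), E; split=> //; first exact: measurableI.
  by apply: le_lt_trans (Kfin n); apply: le_measure; rewrite ?inE//; exact: measurableI.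
apply: smallest_sub; first exact: sgen.
rewrite subUset; split=> _ [A mA <-]; rewrite setTI.
  have := rectT A (fun=> setT) mA (fun=> measurableT).
  by rewrite (_ : [set t | _] = setT)  ?setXT//; apply/seteqP; split.
have : sigma_algebra setT [set B : set (r.-tuple S) | <<s gen >> (snd @^-1` B)].
  have [h0 hC hU] := sgen; split.
  - by rewrite /= preimage_set0.
  - by move=> C /= /hC; rewrite !setTD.
  - by move=> C /= /hU; rewrite preimage_bigcup.
move=> /smallest_sub; apply; last exact: mA.
move=> B; rewrite -bigcup_seq => -[i _ [E mE <-]] /=; rewrite setTI.
have := rectT setT (fun j => if j == i then E else setT) measurableT.
rewrite setTX (_ : [set t | _] = (fun t => tnth t i) @^-1` E); first apply.
  by move=> j; case: ifP.
apply/seteqP; split=> [t /(_ i)|t Et j]; first by rewrite eqxx.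
by case: eqP => [->|].
Qed.

(** * The covolume as the mass of first returns *)

Lemma borel_action_diagonal (G : topologicalGroupType) d (X : measurableType d)
    (a : G -> X -> X) r : borel_action a -> borel_action (@diagonal_action G d X a r).
Proof.
move=> [a1 aM ma]; split.
- by move=> t; apply: eq_from_tnth => i; rewrite tnth_mktuple a1.
- by move=> g h t; apply: eq_from_tnth => i; rewrite !tnth_mktuple aM.
- apply/measurable_fun_tnthP => i.
  rewrite (_ : _ \o _ = (fun p : borel G * X => a p.1 p.2) \o
     (fun p : borel G * r.-tuple X => (p.1, tnth p.2 i) : borel G * X)); last first.
    by apply/funext => p /=; rewrite tnth_mktuple.
  apply: measurableT_comp ma _; apply/measurable_fun_pair => /=.
    exact: measurable_fst.
  exact: measurableT_comp (measurable_tnth i) measurable_snd.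
Qed.

(** Packages the image measure together with the proof that the map is measurable. *)
Lemma ex_pushforward d1 d2 (T1 : measurableType d1) (T2 : measurableType d2)
    (R : realType) (m : {measure set T1 -> \bar R}) (f : T1 -> T2) :
  measurable_fun setT f ->
  exists P : {measure set T2 -> \bar R}, forall A, P A = m (f @^-1` A).
Proof. by move=> mf; unshelve eexists (pushforward m f). Qed.

Section intersection_model.
Context {R : realType} {G : topologicalGroupType} (lcG : lcsc G) (U : nat -> set G).
Hypothesis bU : precompact_base U.
Variables (mG : {measure set (borel G) -> \bar R}) (hmG : haar_measure mG).
Context {d} {X : measurableType d} (a : G -> X -> X).
Variables (mu : probability X R) (Y : set X) (hXY : transverse_Gspace a mu Y).
Variables (r : nat) (mur : {measure set (r.+1.-tuple X) -> \bar R}).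
Hypothesis hmur : intersection_measure mG a mu Y mur.

Let T := @tuple_power d X Y r.+1.
Let b := @diagonal_action G d X a r.+1.

Let hb : borel_action b.
Proof. exact: (borel_action_diagonal r.+1 (proj2 (tGs_space hXY))). Qed.

Let mT : measurable T.
Proof. by apply: (@measurable_box _ X r.+1 (fun=> Y)) => i; exact: (tGs_measurable hXY). Qed.

Lemma hitting_diagonal t : hitting b T t = [set g | forall i, hitting a Y (tnth t i) g].
Proof.
by apply/seteqP; split=> [g h i|g h i]; have := h i; rewrite /b tnth_mktuple.
Qed.

Lemma locally_finite_hitting_diagonal t : intersection_space a Y t ->
  locally_finite (hitting b T t).
Proof.
move=> [g _ [y Ty <-]] K cK; rewrite hitting_diagonal.
have sat : saturation a Y (a g (tnth y ord0)).
  by exists g => //; exists (tnth y ord0) => //; exact: Ty.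
apply: sub_finite_set (tGs_locally_finite hXY sat cK) => h [hit Kh]; split=> //.
by have := hit ord0; rewrite tnth_mktuple.
Qed.

Lemma hitting_diagonal_neq0 t : intersection_space a Y t -> hitting b T t !=set0.
Proof.
move=> [g _ [y Ty <-]]; exists (g^-1)%g.
by rewrite /hitting/= -/b -(actM hb) mulVg (act1 hb).
Qed.

(** The return times of [t] form a nonempty locally finite set, whose least element
is the unique first return.  The hypotheses on [theta] and [N] exclude the null
sets on which codes are wrong or [D] differs from [first_return]. *)
Lemma count_first_return (theta : X -> traces) (D : set (borel G * r.+1.-tuple traces))
    (N : set (borel G * r.+1.-tuple traces)) t :
  intersection_space a Y t ->
  (forall g, T (b g t) -> forall i, theta (tnth (b g t) i) =
     code U (hitting a Y (tnth (b g t) i))) ->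
  (forall g, T (b g t) -> ~ N (g, [tuple theta (tnth (b g t) i) | i < r.+1])) ->
  (forall z, ~ N z -> (first_return U z <-> D z)) ->
  counting [set g | T (b g t) /\ D (g, [tuple theta (tnth (b g t) i) | i < r.+1])]
   = 1 :> \bar R.
Proof.
move=> It thetaE notN DE; have [hG _ _] := lcG; have ha : borel_action a by case: (tGs_space hXY).
have lfT := locally_finite_hitting_diagonal It.
have [g0 Tg0 g0min] := lexlt_min bU hG lfT (hitting_diagonal_neq0 It).
have key g : T (b g t) ->
    (D (g, [tuple theta (tnth (b g t) i) | i < r.+1]) <->
     forall h, hitting b T t h -> ~ lexlt U h g).
  move=> Tg; have dec i : decode U (theta (tnth (b g t) i)) =
      [set k | hitting a Y (tnth t i) (k * g)%g].
    rewrite thetaE// (decode_code bU hG).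
      by rewrite [in LHS]/b tnth_mktuple hittingM.
    apply: (tGs_locally_finite hXY).
    exists 1%g => //; exists (tnth (b g t) i); first exact: Tg.
    exact: act1.
  rewrite -DE; last exact: notN.
  split=> [fr h hit|hmin k dk].
    have := fr (h * g^-1)%g => /=; rewrite mulgVK; apply=> i.
    by rewrite tnth_mktuple dec/= mulgVK; move: hit; rewrite hitting_diagonal; exact.
  apply: hmin; rewrite hitting_diagonal => i.
  by have := dk i; rewrite tnth_mktuple dec.
rewrite (_ : [set g | _] = [set g0]) ?counting_set1//.
apply/seteqP; split=> [g [Tg /(key g Tg) gmin]|g ->]; last by split=> //; exact/key.
apply: contrapT => /(lexlt_total bU hG)[]; [exact: g0min|exact: gmin].
Qed.

(** The data through which the covolume depends on the space: the law [L] of the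
code of the return times under [muY], which is expressed by return times under
[mu], and a measure [P] determined by [L] whose mass on first returns is the
covolume. *)
Lemma trace_model : exists (L : {measure set traces -> \bar R})
    (P : {measure set (borel G * r.+1.-tuple traces) -> \bar R}),
  [/\ L setT < +oo,
   forall (K : set (borel G)) (E : set traces), measurable K -> mG K < +oo -> measurable E ->
     ae_mfun mu (fun x => local_stat U K E (hitting a Y x)) /\
     mG K * L E = \int[mu]_x local_stat U K E (hitting a Y x),
   forall (A : set (borel G)) (E : 'I_r.+1 -> set traces),
     measurable A -> mG A < +oo -> (forall i, measurable (E i)) ->
     P (A `*` [set t | forall i, E i (tnth t i)]) = mG A * \prod_(i < r.+1) L (E i) &
   forall D N, measurable D -> measurable N -> P N = 0 ->
     (forall z, ~ N z -> (first_return U z <-> D z)) -> P D = mur setT].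
Proof.
have ha : borel_action a by case: (tGs_space hXY).
have mY := tGs_measurable hXY.
have [srur _ carr [muY [muYr [hmuY prodY hmuYr]]]] := hmur.
have smu : sigma_finite setT mu.
  by apply: fin_sigma_finite; rewrite (le_lt_trans (@probability_le1 _ _ _ mu _ _))// ltry.
have muYfin := transverse_measure_finite lcG ha mY smu hmG hmuY (tGs_locally_integrable hXY).
have [theta [N [mtheta mN N0 thetaE]]] := trace_map lcG bU ha mY (fin_sigma_finite muYfin).
have [Q hQ] := palm_measure lcG hb mT srur.
pose thr (t : r.+1.-tuple X) : r.+1.-tuple traces := [tuple theta (tnth t i) | i < r.+1].
have mthr : measurable_fun setT thr.
  apply/measurable_fun_tnthP => i.
  rewrite (_ : _ \o _ = theta \o (fun t => tnth t i)); last first.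
    by apply/funext => t /=; rewrite tnth_mktuple.
  exact: measurableT_comp mtheta (measurable_tnth i).
pose psi (p : borel G * r.+1.-tuple X) : borel G * r.+1.-tuple traces := (p.1, thr p.2).
have mpsi : measurable_fun setT psi.
  apply/measurable_fun_pair; first exact: measurable_fst.
  exact: measurableT_comp mthr measurable_snd.
have muYrfin : muYr setT < +oo.
  rewrite (_ : setT = [set t : r.+1.-tuple X | forall i, setT (tnth t i)]); last first.
    by apply/seteqP; split.
  rewrite (prodY (fun=> setT))//.
  rewrite -ge0_fin_numE ?prode_ge0//.
  by apply: prode_fin_num => i _; rewrite ge0_fin_numE.
have bad0 : muYr [set t | exists i, N (tnth t i)] = 0.
  rewrite (_ : [set t | _] = \bigcup_(i in [set: 'I_r.+1]) [set t | N (tnth t i)]); last first.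
    by apply/seteqP; split=> [t [i Ni]|t [i _ Ni]]; exists i.
  rewrite (_ : \bigcup_(i in _) _ = \big[setU/set0]_(i < r.+1) [set t | N (tnth t i)]); last first.
    by rewrite -bigcup_seq; apply: eq_bigcupl; split=> i // _; rewrite /= mem_index_enum.
  apply/negligibleP.
    by apply: bigsetU_measurable => i _; exact: measurable_preimage (measurable_tnth i) mN.
  apply: big_ind; [exact: negligible_set0|exact: negligibleU|] => i _.
  apply/negligibleP; first exact: measurable_preimage (measurable_tnth i) mN.
  rewrite (_ : [set t | _] = [set t | forall j, (if j == i then N else setT) (tnth t j)]).
    apply: etrans (prodY (fun j => if j == i then N else setT) _) _.
      by move=> j; case: ifP.
    by rewrite (bigD1 i)//= eqxx N0 mul0e.
  apply/seteqP; split=> [t Nt j|t /(_ i)]; last by rewrite eqxx.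
  by case: eqP => [->|].
have [L LE] := ex_pushforward muY mtheta.
have [P PE] := ex_pushforward Q mpsi.
exists L, P; split.
- by rewrite LE.
- move=> K E mK Kfin mE; rewrite LE.
  exact: (local_stat_law lcG ha mY smu hmG hmuY muYfin mtheta mN N0 thetaE mK Kfin mE).
- move=> A E mA Afin mE; rewrite PE.
  rewrite (_ : _ @^-1` _ = A `*` [set t | forall i, (theta @^-1` E i) (tnth t i)]).
    have mtE i : measurable (theta @^-1` E i) by exact: measurable_preimage mtheta (mE i).
    apply: etrans (palm_rect lcG hb mT srur hmG hmuYr hQ muYrfin mA Afin (measurable_box mtE)) _.
    congr (_ * _); apply: etrans (prodY _ mtE) _.
    by apply: eq_bigr => i _; rewrite LE.
  apply/seteqP; split=> [[g t] [/= Ag h]|[g t] [/= Ag h]]; split=> //= i;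
    by have := h i; rewrite tnth_mktuple.
- move=> D M mD mM M0 DE; rewrite PE hQ.
  have mpM : measurable (psi @^-1` M) by exact: measurable_preimage mpsi mM.
  have QM0 : Q (psi @^-1` M) = 0 by rewrite -PE.
  have aeM := palm_null lcG hb mT srur hQ mpM QM0.
  have mbad : measurable [set t : r.+1.-tuple X | exists i, N (tnth t i)].
    rewrite (_ : [set t | _] = ~` [set t | forall i, (~` N) (tnth t i)]).
      apply: measurableC; apply: (@measurable_box _ X r.+1 (fun=> ~` N)) => _.
      exact: measurableC.
    apply/seteqP; split=> [t [i Ni] h|t /existsNP[i /contrapT Ni]]; last by exists i.
    exact: (h i).
  have aeN := transverse_null lcG hb mT srur hmG hmuYr hQ muYrfin mbad bad0.
  have ae1 : \forall t \ae mur, counting (returns b T (psi @^-1` D) t) = 1 :> \bar R.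
    apply: filterS3 carr aeM aeN => t It hM hN.
    apply: (count_first_return It _ _ DE) => g Tg; last exact: hM.
    by move=> i; rewrite thetaE// => Ni; apply: (hN g Tg); exists i.
  have [B [mB B0 hB]] := ae1.
  rewrite (ae_eq_lower_integral (f' := cst 1) (N := B))//.
  + by rewrite integral_cst// mul1e.
  + by move=> t; exact: counting_ge0.
  + by move=> t nB; apply: contrapT => h; apply: nB; exact: hB.
Qed.
End intersection_model.

(** * Invariance of the intersection covolume *)

Lemma haar_weight {G : topologicalGroupType} (lcG : lcsc G) {R : realType}
    (mG : {measure set (borel G) -> \bar R}) : haar_measure mG ->
  exists w : borel G -> \bar R, [/\ measurable_fun setT w, forall g, 0 <= w g &
    \int[mG]_g w g = 1].
Proof.
move=> hmG; have [K [cK mK /andP[K0 Kfin]]] := haar_compact_pos lcG hmG.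
have fK : mG K = (fine (mG K))%:E by rewrite fineK// ge0_fin_numE.
have K0' : (0 < fine (mG K))%R by rewrite -lte_fin -fK.
exists (fun g => (fine (mG K))^-1%:E * (\1_K g)%:E); split.
- by apply: measurable_funeM; exact/measurable_EFinP.
- by move=> g; rewrite mule_ge0// lee_fin ltW// invr_gt0.
- rewrite (@ge0_integralZl_EFin _ _ _ mG setT measurableT (fun g => (\1_K g)%:E)).
  + by rewrite integral_indic// setIT fK -EFinM mulVf// gt_eqF.
  + by move=> g _; rewrite lee_fin.
  + exact/measurable_EFinP.
  + by rewrite ltW// invr_gt0.
Qed.

Lemma mule_eq1_inj (R : realType) (s x y : \bar R) :
  0 <= s -> 0 <= x -> 0 <= y -> s * x = 1 -> s * y = 1 -> x = y.
Proof.
have fin (u v : \bar R) : 0 <= u -> 0 <= v -> u * v = 1 -> u \is a fin_num.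
  case: u => [u|_|]//; rewrite le_eqVlt => /predU1P[<-|v0]; last by rewrite gt0_mulye.
  by rewrite mule0 => -[] /eqP; rewrite eq_sym oner_eq0.
move=> s0 x0 y0 sx sy.
have fs := fin _ _ s0 x0 sx.
have fx : x \is a fin_num by apply: fin x0 s0 _; rewrite muleC.
have fy : y \is a fin_num by apply: fin y0 s0 _; rewrite muleC.
by rewrite -[x]mul1e -sy [s * y]muleC -muleA sx mule1.
Qed.

(** The space of 0-tuples is a point, which every element of the group returns to
itself, so the transverse formula reduces to one scalar equation, whose
coefficient depends on [G] and the weight only. *)
Lemma covolume_arity0 {G : topologicalGroupType} {R : realType} {d} {X : measurableType d}
    (mG : {measure set (borel G) -> \bar R}) (a : G -> X -> X) (mu : probability X R)
    (Y : set X) (mur : {measure set (0.-tuple X) -> \bar R}) (w : borel G -> \bar R) :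
  intersection_measure mG a mu Y mur -> measurable_fun setT w -> (forall g, 0 <= w g) ->
  \int[mG]_g w g = 1 -> (\esum_(g in [set: G]) w g) * mur setT = 1.
Proof.
move=> [_ _ _ [muY [muYr [_ prodY [_ hY]]]]] mw w0 w1.
have mf : measurable_fun (@tuple_power d X Y 0) (cst (1 : \bar R)) by [].
have := hY w (cst 1) mw w0 w1 mf (fun _ _ => lee01).
have TT : @tuple_power d X Y 0 = setT by apply/seteqP; split=> // t _ [].
rewrite TT integral_cst// mul1e.
have -> : muYr setT = 1.
  have := prodY (fun=> setT) (fun=> measurableT); rewrite big_ord0 => <-.
  by congr (muYr _); apply/seteqP; split=> // t _ [].
move=> ->; rewrite -integral_cst//; apply: eq_integral => t _ /=.
have -> : hitting (@diagonal_action G d X a 0) setT t = setT by exact/seteqP.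
by apply: eq_esum => g _; rewrite mul1e.
Qed.

Theorem proposition7p5 (R : realType) (G : topologicalGroupType)
    (hG : lcsc G) (mG : {measure set (borel G) -> \bar R})
    (hmG : haar_measure mG) (hunimodular : right_invariant mG)
    (dX : measure_display) (X : measurableType dX) (a : G -> X -> X)
    (mu : probability X R) (Y : set X) (hXY : transverse_Gspace a mu Y)
    (dW : measure_display) (W : measurableType dW) (b : G -> W -> W)
    (nu : probability W R) (Z : set W) (hWZ : transverse_Gspace b nu Z)
    (hfactor : exists phi : X -> W, transverse_Gfactor a mu Y b nu Z phi)
    (r : nat)
    (mur : {measure set (r.-tuple X) -> \bar R})
    (hmur : intersection_measure mG a mu Y mur)
    (nur : {measure set (r.-tuple W) -> \bar R})
    (hnur : intersection_measure mG b nu Z nur) :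
  intersection_covolume mur = intersection_covolume nur.
Proof.
rewrite /intersection_covolume.
have [K [cK mK /andP[K0 Kfin]]] := haar_compact_pos hG hmG.
have fK : mG K = (fine (mG K))%:E by rewrite fineK// ge0_fin_numE.
have K0' : (0 < fine (mG K))%R by rewrite -lte_fin -fK.
case: r mur hmur nur hnur => [|r] mur hmur nur hnur.
  have [w [mw w0 w1]] := haar_weight hG hmG.
  apply: (mule_eq1_inj _ _ _ (covolume_arity0 hmur mw w0 w1) (covolume_arity0 hnur mw w0 w1)) => //.
  by apply: esum_ge0 => g _; exact: w0.
have [U [oU cU nU]] := lcsc_precompact_base hG.
have bU : precompact_base U by [].
have [phi hphi] := hfactor.
have [L [P [Lfin Llaw Prect Pcov]]] := trace_model hG bU hmG hXY hmur.
have [L' [P' [L'fin L'law P'rect P'cov]]] := trace_model hG bU hmG hWZ hnur.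
(* A compact set K of positive Haar measure suffices to recover L E. *)
have LL' E : measurable E -> L E = L' E.
  move=> mE; have [aeL LE] := Llaw K E mK Kfin mE.
  have [aeL' L'E] := L'law K E mK Kfin mE.
  have fin_le (M : {measure set traces -> \bar R}) : M setT < +oo -> M E = (fine (M E))%:E.
    move=> Mfin; rewrite fineK// ge0_fin_numE//; apply: le_lt_trans Mfin.
    by apply: le_measure; rewrite ?inE.
  have := factor_integral_hitting (xi := local_stat U K E) hphi (fun S => counting_ge0 R _) aeL aeL'.
  rewrite -LE -L'E fK (fin_le L)// (fin_le L')// -!EFinM => -[] /mulfI h.
  by rewrite h// gt_eqF.
have [F [cF FT]] := open_sigma_compact hG (@openT G).
have [haus _ _] := hG.
have mF n : measurable (F n : set (borel G)) by exact: compact_measurable.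
have Ffin n : mG (F n) < +oo by exact: haar_compact.
pose Fr n : set (borel G * r.+1.-tuple traces) :=
  F n `*` [set t | forall i, setT (tnth t i)].
have FrT : \bigcup_n Fr n = setT.
  apply/seteqP; split=> // -[g t] _.
  have : (\bigcup_n F n) g by rewrite -FT.
  by move=> [n _ Fg]; exists n.
have PFr n : P (Fr n) < +oo.
  have -> : P (Fr n) = mG (F n) * \prod_(i < r.+1) L setT.
    exact: (Prect (F n) (fun=> setT)).
  have fL : L setT \is a fin_num by rewrite ge0_fin_numE.
  by rewrite -ge0_fin_numE ?mule_ge0 ?prode_ge0// fin_numM ?prode_fin_num ?ge0_fin_numE.
(* The boxes on which P and P' agree are stable under intersection. *)
have PP' D : measurable D -> P D = P' D.
  apply: (measure_unique _ Fr (measurable_rect_generator hG hmG r.+1 _)) => //.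
  - move=> _ _ [A [E [mA Afin mE ->]]] [B [H [mB Bfin mH ->]]].
    exists (A `&` B), (fun i => E i `&` H i); split.
    + exact: measurableI.
    + by apply: le_lt_trans Afin; apply: le_measure; rewrite ?inE//; exact: measurableI.
    + by move=> i; exact: measurableI.
    + rewrite -setXI; congr (_ `*` _); apply/seteqP; split=> [t [h k] i|t h].
        by split; [exact: h|exact: k].
      by split=> i; have [] := h i.
  - by move=> n; exists (F n), (fun=> setT).
  - move=> _ [A [E [mA Afin mE ->]]]; apply: etrans (Prect A E mA Afin mE) _.
    apply: etrans (esym (P'rect A E mA Afin mE)).
    by congr (_ * _); apply: eq_bigr => i _; exact: LL'.
have sP : sigma_finite setT P.
  exists Fr => // n; split=> //.
  by apply: measurableX => //; exact: (@measurable_box _ traces r.+1 (fun=> setT)).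
have [D [M [mD mM M0 DE]]] := ae_measurable_first_return hG bU sP.
rewrite -(Pcov D M mD mM M0 DE) -(P'cov D M mD mM _ DE) -?PP'//.
Qed.
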